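(* Let $R^i_t=v^i(R)\,R^i_x$, $i=1,2,3$, be a three-component system of hydrodynamic type in Riemann invariants $R=(R^1,R^2,R^3)$, with smooth, real and pairwise distinct characteristic velocities $v^i$ on an open set of the hodograph space. Write $v^i_j=\partial v^i/\partial R^j$, and let a subscript $k$ on a bracket denote $\partial/\partial R^k$. Assume that the system is linearly degenerate, i.e. $v^i_i=0$ for all $i$, and semi-Hamiltonian, i.e. $$\left(\frac{v^i_j}{v^j-v^i}\right)_k=\left(\frac{v^i_k}{v^k-v^i}\right)_j\quad\text{for all pairwise distinct } i,j,k.$$ Let $M$ be a smooth surface in the hodograph space on which the restrictions of $dR^1,dR^2,dR^3$ are pairwise linearly independent at every point. Then $M$ is a hydrodynamic surface of the system if and only if the 3-web cut on $M$ by the coordinate planes $R^1=\mathrm{const}$, $R^2=\mathrm{const}$, $R^3=\mathrm{const}$ is hexagonal. Equivalently, writing $M$ locally as $R^3=R^3(R^1,R^2)$, the hydrodynamic surfaces of every such system are governed by one and the same equation $$\left(\ln\left|\frac{R^3_1}{R^3_2}\right|\right)_{12}=0,$$ where the subscripts $1,2$ on $R^3$ and on the bracket denote partial derivatives with respect to $R^1$ and $R^2$.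
   Context: All objects are smooth and all considerations are local. A hydrodynamic surface is a solution of the system viewed as a non-parametrized surface in the hodograph space. That is, it is a surface $M$ such that near each point of $M$ there are local coordinates $(x,t)$ on $M$ for which the embedding $R=R(x,t)$ is a solution of the system. For a 3-web (three families of curves in pairwise distinct directions) on a surface, choose 1-forms $\phi^1,\phi^2$ such that the three families are given by $\phi^1=0$, $\phi^2=0$ and $\phi^1=\phi^2$. The connection form $\phi$ is the unique 1-form with $d\phi^1=\phi\wedge\phi^1$ and $d\phi^2=\phi\wedge\phi^2$. The curvature form is $C=d\phi$, which is independent of the choice of $\phi^1,\phi^2$. The web is called hexagonal if $C=0$. *)

(* Defs.v *)
(* Everything is stated over an arbitrary [R : realType]. *)
From HB Require Import structures.
From mathcomp Require Import all_boot all_order all_algebra.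
From mathcomp Require Import all_classical all_reals all_analysis.

Set Implicit Arguments.
Unset Strict Implicit.
Unset Printing Implicit Defensive.

Import Order.TTheory GRing.Theory Num.Theory.
Import numFieldNormedType.Exports.

Local Open Scope classical_set_scope.
Local Open Scope ring_scope.

(* Indices are shifted by one: the Riemann invariants R^1, R^2, R^3 are the
   coordinates 0, 1, 2 of the hodograph space ['rV[R]_3]. *)

Section Calculus.
Context {R : realType}.

Definition partial n (j : 'I_n) (f : 'rV[R]_n -> R) : 'rV[R]_n -> R :=
  'D_(delta_mx 0 j) f.

Fixpoint Ck n (k : nat) (U : set 'rV[R]_n) (f : 'rV[R]_n -> R) : Prop :=
  match k with
  | 0%N => forall p, U p -> {for p, continuous f}
  | k'.+1 => (forall p, U p -> differentiable f p) /\
             (forall j : 'I_n, Ck k' U (partial j f))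
  end.

(* Meaningful for open [U]. *)
Definition smooth n (U : set 'rV[R]_n) (f : 'rV[R]_n -> R) : Prop :=
  forall k, Ck k U f.

Definition component m n (r : 'rV[R]_m -> 'rV[R]_n) (i : 'I_n) : 'rV[R]_m -> R :=
  fun w => r w 0 i.

Definition smooth_map m n (W : set 'rV[R]_m) (r : 'rV[R]_m -> 'rV[R]_n) : Prop :=
  forall i, smooth W (component r i).

(* A 1-form on (an open set of) the plane is given by its coefficients: [phi w]
   is the covector phi_0 dw_0 + phi_1 dw_1, whose value on a tangent vector
   [h : 'cV_2] is [phi w *m h].  A 2-form is identified with its coefficient of
   dw_0 /\ dw_1. *)
Definition form1 := 'rV[R]_2 -> 'rV[R]_2.

Definition differential (f : 'rV[R]_2 -> R) : form1 :=
  fun w => \row_j partial j f w.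

Definition wedge (phi psi : form1) : 'rV[R]_2 -> R :=
  fun w => phi w 0 0 * psi w 0 1 - phi w 0 1 * psi w 0 0.

Definition exterior (phi : form1) : 'rV[R]_2 -> R :=
  fun w => partial 0 (component phi 1) w - partial 1 (component phi 0) w.

End Calculus.

Section Webs.
Context {R : realType}.
Implicit Types (W : set 'rV[R]_2) (f : 'I_3 -> 'rV[R]_2 -> R).
Implicit Types phi : @form1 R.

(* The [i]-th family of curves of the web is [f i = const]; a family is compared
   with the one cut out by a 1-form through their tangent directions. *)
Definition web_coframe W f phi1 phi2 : Prop :=
  [/\ smooth_map W phi1, smooth_map W phi2
    & forall w, W w -> forall h : 'cV[R]_2,
      [/\ phi1 w *m h = 0 <-> differential (f 0) w *m h = 0,
          phi2 w *m h = 0 <-> differential (f 1) w *m h = 0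
        & phi1 w *m h = phi2 w *m h <-> differential (f 2) w *m h = 0]].

Definition connection_form W phi1 phi2 phi : Prop :=
  smooth_map W phi /\
  forall w, W w -> exterior phi1 w = wedge phi phi1 w /\
                   exterior phi2 w = wedge phi phi2 w.

(* The curvature [exterior phi] does not depend on the choice of the coframe. *)
Definition hexagonal_web W f : Prop :=
  exists phi1 phi2 phi,
    [/\ web_coframe W f phi1 phi2, connection_form W phi1 phi2 phi
      & forall w, W w -> exterior phi w = 0].

End Webs.

Section Surfaces.
Context {R : realType}.
Implicit Types (M : set 'rV[R]_3) (W : set 'rV[R]_2).
Implicit Types r : 'rV[R]_2 -> 'rV[R]_3.

(* [r : W -> M] is the inverse of a local coordinate system on [M]; the last
   clause says that it is a homeomorphism onto a relatively open part of [M]. *)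
Definition local_parametrization M W r : Prop :=
  [/\ open W,
      smooth_map W r,
      forall w, W w -> free [:: 'D_(delta_mx 0 0) r w; 'D_(delta_mx 0 1) r w],
      {in W &, injective r}
    & forall W', open W' -> W' `<=` W ->
        exists2 V : set 'rV[R]_3, open V & r @` W' = M `&` V].

Definition smooth_surface M : Prop :=
  forall p, M p -> exists W r, local_parametrization M W r /\ (r @` W) p.

Definition transversal_surface M : Prop :=
  forall W r, local_parametrization M W r -> forall w, W w ->
    forall i j : 'I_3, i != j ->
      free [:: differential (component r i) w; differential (component r j) w].

(* The coordinates of the parameter plane are x (index 0) and t (index 1). *)
Definition hydrodynamic_solution (v : 'I_3 -> 'rV[R]_3 -> R) W r : Prop :=
  forall w, W w -> forall i,
    partial 1 (component r i) w = v i (r w) * partial 0 (component r i) w.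

Definition hydrodynamic_surface (v : 'I_3 -> 'rV[R]_3 -> R) M : Prop :=
  forall p, M p -> exists W r,
    [/\ local_parametrization M W r, (r @` W) p & hydrodynamic_solution v W r].

(* The web cut on [M] by the coordinate planes of the hodograph space. *)
Definition hexagonal_surface M : Prop :=
  forall p, M p -> exists W r,
    [/\ local_parametrization M W r, (r @` W) p & hexagonal_web W (component r)].

Definition graph_map (f : 'rV[R]_2 -> R) : 'rV[R]_2 -> 'rV[R]_3 :=
  fun w => row_mx w (const_mx (f w) : 'rV[R]_1).

Definition web_equation W (f : 'rV[R]_2 -> R) : Prop :=
  forall w, W w ->
    partial 1 (partial 0 (fun u => ln `|partial 0 f u / partial 1 f u|)) w = 0.

End Surfaces.

Section Systems.
Context {R : realType}.
Implicit Types (U : set 'rV[R]_3) (v : 'I_3 -> 'rV[R]_3 -> R).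

Definition linearly_degenerate U v : Prop :=
  forall i p, U p -> partial i (v i) p = 0.

Definition semi_hamiltonian U v : Prop :=
  forall i j k : 'I_3, i != j -> i != k -> j != k -> forall p, U p ->
    partial k (fun q => partial j (v i) q / (v j q - v i q)) p =
    partial j (fun q => partial k (v i) q / (v k q - v i q)) p.

End Systems.

(* Main.v *)
(** Write the surface as [R^3 = f(R^1, R^2)] and put [q = f_1 / f_2], so that the
web equation reads [(q_1 / q)_2 = 0].  The inverse [(x, t)] of a solution,
viewed as a pair of functions of [(R^1, R^2)], satisfies
[x_2 = - v^1 t_2], [x_1 = - v^2 t_1] and
[(v^3 - v^2) t_1 f_2 = (v^3 - v^1) t_2 f_1].  Eliminating [x], the functions
[m = t_1 (v^3 - v^2)] and [n = t_2 (v^3 - v^1)] satisfy [m = q n],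
[m_2 / m = b] and [n_1 / n = a], where [a dR^1 + b dR^2] is the restriction to the
surface of a 1-form on the hodograph space which only depends on the [v^i].
This 1-form is closed as soon as the system is linearly degenerate and
semi-Hamiltonian.  Hence [(q_1 / q)_2 = b_1 - a_2 = 0].  Conversely, if
[(q_1 / q)_2 = 0], then [(a + q_1 / q) dR^1 + b dR^2] is closed and three
successive quadratures give [m], [t] and [x]; the inverse function theorem
turns [(x, t)] into coordinates.

In the coordinates [(R^1, R^2)] the web has the coframe [f_1 dR^1], [- f_2 dR^2],
whose curvature is [(q_1 / q)_2]; an arbitrary parametrization and an
arbitrary coframe are compared with this one through the map [(R^1, R^2)]. *)

Require Import Defs.
From HB Require Import structures.
From mathcomp Require Import all_boot all_order all_algebra.
From mathcomp Require Import all_classical all_reals all_analysis.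
From mathcomp Require Import ring lra.

Set Implicit Arguments.
Unset Strict Implicit.
Unset Printing Implicit Defensive.

Import Order.TTheory GRing.Theory Num.Theory.
Import numFieldNormedType.Exports.

Local Open Scope classical_set_scope.
Local Open Scope ring_scope.

(** * Differentiability by linear approximation, and the chain rule in coordinates *)

Section Differentiability.
Context {R : realType}.

(** Why m and n are the right unknowns: m = q n is the third equation of the solution, so ln|q| =
    ln|m| - ln|n|, and its mixed derivative is known once m_2 / m and n_1 / n are. Equality of the
    mixed derivatives of x expresses t_12 through t_1 and t_2; linear degeneracy kills v^1_1 and
    v^2_2, so only derivatives of v^1 and v^2 along R^3 remain in it. The third equation then
    eliminates t_2 / t_1, and each logarithmic derivative is affine in a single slope of f. This is
    why the two are the coefficients of the pullback of a fixed 1-form.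

    Hydrodynamicity and hexagonality each provide some parametrization near a point, unrelated to a
    graph given in advance. Relative openness of the images, together with the independence of dR^1
    and dR^2, makes (R^1, R^2) a common coordinate system there.

    Smoothness is C^k for every k, where C^k is a recursion over partial derivatives on an open set;
    hence the many inductions on k. *)

Lemma differentiable_eps (V W : normedModType R) (f : V -> W)
    (L : {linear V -> W}) (p : V) : continuous L ->
  (forall e, 0 < e -> \forall h \near (0 : V),
     `|f (h + p) - f p - L h| <= e * `|h|) ->
  differentiable f p /\ 'd f p = L :> (V -> W).
Proof.
move=> cL fL.
have H : f \o shift p = cst (f p) + L +o_ (0 : V) id.
  apply/eqaddoE/eqaddoP => e e0; have := fL e e0; apply: filter_app.
  near=> h; rewrite /= -[X in _ -> `|X| <= _]/(f (h + p) - (f p + L h)).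
  by rewrite opprD addrA.
have dE := diff_unique cL H.
by split=> //; apply/diff_locallyP; rewrite dE; split.
Unshelve. all: by end_near. Qed.

Lemma near_eq_differentiable (V W : normedModType R) (f g : V -> W) (p : V) :
  (\forall x \near p, f x = g x) -> differentiable f p -> differentiable g p.
Proof.
move=> fg df; suff [] : differentiable g p /\ 'd g p = 'd f p :> (V -> W) by [].
apply: differentiable_eps => [|e e0]; first exact: diff_continuous.
have /diff_locally/eqaddoP/(_ e e0) := df.
have fg0 : \forall h \near (0 : V), f (h + p) = g (h + p).
  by move: fg; rewrite (near_shift 0 p) /= subr0.
move: fg0; apply: filter_app2; near=> h.
move=> fgh; rewrite /= -[X in `|X| <= _ -> _]/(f (h + p) - (f p + 'd f p h)).
by rewrite opprD addrA fgh (nbhs_singleton fg).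
Unshelve. all: by end_near. Qed.

Lemma near_and (T : topologicalType) (p : T) (P Q : set T) :
  (\forall x \near p, P x) -> (\forall x \near p, Q x) ->
  \forall x \near p, P x /\ Q x.
Proof. by move=> nP nQ; apply: filterI. Qed.

Lemma near_norm (V : normedModType R) (p : V) (P : set V) :
  (\forall x \near p, P x) ->
  exists2 d : R, 0 < d & forall x, `|p - x| < d -> P x.
Proof.
move=> /nbhs_ballP[d /= d0 dP]; exists d => // x px.
by apply: dP; rewrite -ball_normE.
Qed.

Lemma ler_dist_half (a b c e : R) :
  `|a - c| < e / 2 -> `|b - c| < e / 2 -> `|a - b| <= e.
Proof.
move=> ac bc; rewrite -(subrKA c) (splitr e).
by rewrite (le_trans (ler_normD _ _)) // lerD ?(ltW ac) // distrC ltW.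
Qed.

Lemma rV_basis n (x : 'rV[R]_n) : x = \sum_i x 0 i *: delta_mx 0 i.
Proof. exact: row_sum_delta. Qed.

Lemma component_sum m n (s : 'rV[R]_m -> 'rV[R]_n) :
  s = (fun w => \sum_i component s i w *: delta_mx 0 i).
Proof. by apply/funext => w; rewrite [LHS]rV_basis. Qed.

Lemma continuous_component m n (s : 'rV[R]_m -> 'rV[R]_n) w :
  (forall i, {for w, continuous (component s i)}) -> {for w, continuous s}.
Proof.
move=> cs; rewrite [s]component_sum.
have -> : (fun w : 'rV[R]_m => \sum_i component s i w *: (delta_mx 0 i : 'rV[R]_n))
  = \sum_i (fun w => component s i w *: delta_mx 0 i).
  by apply/funext => x; rewrite fct_sumE.
elim/big_ind : _ => [|g h cg ch|i _].
- exact: cst_continuous.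
- exact: continuousD.
- by apply: continuousZr_tmp; exact: cs.
Qed.

Lemma differentiable_component m n (s : 'rV[R]_m -> 'rV[R]_n) w :
  (forall i, differentiable (component s i) w) -> differentiable s w.
Proof.
move=> ds; rewrite [s]component_sum.
have -> : (fun w : 'rV[R]_m => \sum_i component s i w *: (delta_mx 0 i : 'rV[R]_n))
  = \sum_i (fun w => component s i w *: delta_mx 0 i).
  by apply/funext => x; rewrite fct_sumE.
apply: differentiable_sum => i; exact: differentiableZl.
Qed.

Lemma partial_comp m n (f : 'rV[R]_n -> R) (s : 'rV[R]_m -> 'rV[R]_n) w j :
  differentiable f (s w) -> (forall i, differentiable (component s i) w) ->
  partial j (f \o s) w =
  \sum_i partial i f (s w) * partial j (component s i) w.
Proof.
move=> df ds; have ds' := differentiable_component ds.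
rewrite /partial deriveE; last exact: differentiable_comp.
rewrite diff_comp //= -(deriveE _ ds') derive_mx; last exact: diff_derivable.
rewrite [X in 'd f _ X]rV_basis linear_sum /=; apply: eq_bigr => i _.
by rewrite linearZ /= mxE -deriveE // mulrC.
Qed.

End Differentiability.

(** * Calculus of smooth functions on an open set *)

Section SmoothCalculus.
Context {R : realType}.

Section OneDomain.
Context {n : nat}.
Implicit Types (U : set 'rV[R]_n) (f g : 'rV[R]_n -> R).

Lemma Ck_continuous k U f p : Ck k U f -> U p -> {for p, continuous f}.
Proof.
case: k => [cf Up|k [df _] Up]; first exact: cf.
exact: differentiable_continuous (df p Up).
Qed.

Lemma CkW k U f : Ck k.+1 U f -> Ck k U f.
Proof.
elim: k f => [|k IH] f [df pf].
  by move=> p Up; exact: differentiable_continuous (df p Up).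
by split=> // j; apply: IH; exact: pf.
Qed.

Lemma Ck_sub k U V f : V `<=` U -> Ck k U f -> Ck k V f.
Proof.
move=> VU; elim: k f => [|k IH] f; first by move=> cf p Vp; exact: (cf p (VU p Vp)).
move=> [df pf]; split=> [p Vp|j]; first exact: (df p (VU p Vp)).
exact: IH (pf j).
Qed.

Lemma open_near U f g p : open U -> (forall x, U x -> f x = g x) -> U p ->
  \forall x \near p, f x = g x.
Proof. by move=> oU fg Up; apply: filterS fg _; exact: open_nbhs_nbhs. Qed.

Lemma partial_congr U f g j p : open U -> (forall x, U x -> f x = g x) -> U p ->
  partial j f p = partial j g p.
Proof. by move=> oU fg Up; apply: near_eq_derive; exact: (open_near oU fg Up). Qed.

(** Formulas for derivatives are in general available on [U] only, not as equalities of functions.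
    Openness turns equality on [U] into equality near each of its points, hence passes it to all
    partial derivatives; the induction steps of the closure properties rely on this. *)
Lemma Ck_congr k U f g : open U -> (forall x, U x -> f x = g x) ->
  Ck k U f -> Ck k U g.
Proof.
move=> oU; elim: k f g => [|k IH] f g fg.
  move=> cf p Up; rewrite /prop_for /continuous_at -(fg p Up).
  apply: cvg_trans (cf p Up).
  exact: (@near_eq_cvg _ _ (nbhs p) _ f g (open_near oU fg Up)).
move=> [df pf]; split=> [p Up|j].
  by apply: (near_eq_differentiable _ (df p Up)); exact: (open_near oU fg Up).
by apply: IH (pf j) => p Up; exact: (partial_congr _ oU fg Up).
Qed.

Lemma CkD k U f g : open U -> Ck k U f -> Ck k U g -> Ck k U (fun x => f x + g x).
Proof.
move=> oU; elim: k f g => [|k IH] f g.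
  by move=> cf cg p Up; exact: continuousD (cf p Up) (cg p Up).
move=> [df pf] [dg pg]; split=> [p Up|j].
  exact: differentiableD (df p Up) (dg p Up).
apply: Ck_congr (IH _ _ (pf j) (pg j)) => // p Up.
by rewrite -[RHS]/('D_(delta_mx 0 j) (f \+ g) p) deriveD //;
  apply: diff_derivable; [exact: df|exact: dg].
Qed.

Lemma CkM k U f g : open U -> Ck k U f -> Ck k U g -> Ck k U (fun x => f x * g x).
Proof.
move=> oU; elim: k f g => [|k IH] f g.
  by move=> cf cg p Up; exact: continuousM (cf p Up) (cg p Up).
move=> Cf Cg; have [df pf] := Cf; have [dg pg] := Cg; split=> [p Up|j].
  exact: differentiableM (df p Up) (dg p Up).
apply: Ck_congr (CkD oU (IH _ _ (CkW Cf) (pg j)) (IH _ _ (CkW Cg) (pf j))) => // p Up.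
by rewrite -[RHS]/('D_(delta_mx 0 j) (f \* g) p) deriveM //;
  apply: diff_derivable; [exact: df|exact: dg].
Qed.

Lemma Ck_cst k U c : Ck k U (fun _ => c : R).
Proof.
elim: k c => [|k IH] c; first by move=> p _; exact: cst_continuous.
split=> [p _|j]; first exact: differentiable_cst.
suff -> : partial j (fun=> c) = (fun _ : 'rV[R]_n => 0) by exact: IH.
by apply/funext => p; rewrite /partial derive_cst.
Qed.

Lemma partial_coord (i j : 'I_n) p :
  partial j (fun x : 'rV[R]_n => x 0 i) p = (i == j)%:R.
Proof.
have := derive_mx (@derivable_id R 'rV[R]_n p (delta_mx 0 j)).
rewrite derive_id => /matrixP/(_ 0 i).
by rewrite !mxE /= => ->.
Qed.

Lemma Ck_coord k U (i : 'I_n) : Ck k U (fun x : 'rV[R]_n => x 0 i).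
Proof.
case: k => [p _|k]; first exact/differentiable_continuous/differentiable_coord.
split=> [p _|j]; first exact: differentiable_coord.
have -> : partial j (fun x : 'rV[R]_n => x 0 i) = (fun=> (i == j)%:R).
  by apply/funext => p; rewrite partial_coord.
exact: Ck_cst.
Qed.

Lemma CkV k U f : open U -> (forall x, U x -> f x != 0) -> Ck k U f ->
  Ck k U (fun x => (f x)^-1).
Proof.
move=> oU f0; elim: k => [|k IH].
  by move=> cf p Up; apply: continuousV (f0 p Up) (cf p Up).
move=> Cf; have [df pf] := Cf; split=> [p Up|j].
  exact: differentiableV (df p Up) (f0 p Up).
have CV := IH (CkW Cf).
(* The derivative - f_j / f^2 contains the inverse itself, to which the induction hypothesis [CV]
   applies. *)
apply: Ck_congr (CkM oU (CkM oU CV CV) (CkM oU (Ck_cst k U (-1)) (pf j))) => // p Up.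
rewrite -[RHS]/('D_(delta_mx 0 j) (fun y => (f y)^-1) p) deriveV ?f0 //.
  by rewrite -invfM /partial mulN1r mulrN -expr2 scaleNr.
by apply: diff_derivable; exact: df.
Qed.

Lemma Ck_expR k U f : open U -> Ck k U f -> Ck k U (fun x => expR (f x)).
Proof.
move=> oU; elim: k => [|k IH].
  by move=> cf p Up; apply: continuous_comp (cf p Up) _; exact: continuous_expR.
move=> Cf; have [df pf] := Cf; split=> [p Up|j].
  apply: differentiable_comp; first exact: df.
  by apply/derivable1_diffP; exact: derivable_expR.
apply: Ck_congr (CkM oU (IH (CkW Cf)) (pf j)) => // p Up.
rewrite -[RHS]/('D_(delta_mx 0 j) (expR \o f) p) deriveE; last first.
  apply: differentiable_comp; first exact: df.
  by apply/derivable1_diffP; exact: derivable_expR.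
rewrite diff_comp; [|exact: df|by apply/derivable1_diffP; exact: derivable_expR].
rewrite /= diff1E; last by apply/derivable1_diffP; exact: derivable_expR.
by rewrite derive1E derive_val /partial (deriveE _ (df p Up)) mulrC.
Qed.

Lemma smooth_partial U f j : smooth U f -> smooth U (partial j f).
Proof. by move=> sf k; have [_ pf] := sf k.+1; exact: (pf j). Qed.

Lemma smooth_differentiable U f p : smooth U f -> U p -> differentiable f p.
Proof. by move=> sf; have [df _] := sf 1%N; exact: df. Qed.

Lemma smooth_continuous U f p : smooth U f -> U p -> {for p, continuous f}.
Proof. by move=> sf; exact: (Ck_continuous (sf 0%N)). Qed.

Lemma smooth_sub U V f : V `<=` U -> smooth U f -> smooth V f.
Proof. by move=> VU sf k; exact: Ck_sub VU (sf k). Qed.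

Lemma smooth_congr U f g : open U -> (forall x, U x -> f x = g x) ->
  smooth U f -> smooth U g.
Proof. by move=> oU fg sf k; exact: Ck_congr oU fg (sf k). Qed.

Lemma smooth_cst U c : smooth U (fun=> c : R).
Proof. by move=> k; exact: Ck_cst. Qed.

Lemma smooth_coord U (i : 'I_n) : smooth U (fun x : 'rV[R]_n => x 0 i).
Proof. by move=> k; exact: Ck_coord. Qed.

Lemma smoothD U f g : open U -> smooth U f -> smooth U g ->
  smooth U (fun x => f x + g x).
Proof. by move=> oU sf sg k; exact: CkD. Qed.

Lemma smoothM U f g : open U -> smooth U f -> smooth U g ->
  smooth U (fun x => f x * g x).
Proof. by move=> oU sf sg k; exact: CkM. Qed.

Lemma smoothN U f : open U -> smooth U f -> smooth U (fun x => - f x).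
Proof.
move=> oU sf; apply: smooth_congr (smoothM oU (smooth_cst U (-1)) sf) => //.
by move=> x _; rewrite mulN1r.
Qed.

Lemma smoothB U f g : open U -> smooth U f -> smooth U g ->
  smooth U (fun x => f x - g x).
Proof. by move=> oU sf sg; exact: smoothD (smoothN oU sg). Qed.

Lemma smoothV U f : open U -> (forall x, U x -> f x != 0) -> smooth U f ->
  smooth U (fun x => (f x)^-1).
Proof. by move=> oU f0 sf k; exact: CkV. Qed.

Lemma smooth_div U f g : open U -> (forall x, U x -> g x != 0) ->
  smooth U f -> smooth U g -> smooth U (fun x => f x / g x).
Proof. by move=> oU g0 sf sg; exact: smoothM (smoothV oU g0 sg). Qed.

Lemma smooth_expR U f : open U -> smooth U f -> smooth U (fun x => expR (f x)).
Proof. by move=> oU sf k; exact: Ck_expR. Qed.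

Lemma partial_cst c j p : partial j (fun _ : 'rV[R]_n => c) p = 0.
Proof. by rewrite /partial derive_cst. Qed.

Lemma partialD f g j p : differentiable f p -> differentiable g p ->
  partial j (fun x => f x + g x) p = partial j f p + partial j g p.
Proof.
by move=> df dg; rewrite -[LHS]/('D_(delta_mx 0 j) (f \+ g) p) deriveD //;
  exact: diff_derivable.
Qed.

Lemma partialN f j p : differentiable f p ->
  partial j (fun x => - f x) p = - partial j f p.
Proof. by move=> df; rewrite /partial deriveN //; exact: diff_derivable. Qed.

Lemma partialB f g j p : differentiable f p -> differentiable g p ->
  partial j (fun x => f x - g x) p = partial j f p - partial j g p.
Proof.
move=> df dg; rewrite partialD ?partialN //; exact: differentiableN.
Qed.

Lemma partialM f g j p : differentiable f p -> differentiable g p ->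
  partial j (fun x => f x * g x) p = partial j f p * g p + f p * partial j g p.
Proof.
move=> df dg; rewrite -[LHS]/('D_(delta_mx 0 j) (f \* g) p) deriveM;
  [|exact: diff_derivable..].
rewrite addrC /partial; congr (_ + _); exact: mulrC.
Qed.

Lemma partialV f j p : differentiable f p -> f p != 0 ->
  partial j (fun x => (f x)^-1) p = - partial j f p / f p ^+ 2.
Proof.
move=> df f0; rewrite /partial deriveV //; last exact: diff_derivable.
by rewrite scaleNr mulNr mulrC.
Qed.

Lemma partial_div f g j p : differentiable f p -> differentiable g p ->
  g p != 0 ->
  partial j (fun x => f x / g x) p =
  (partial j f p * g p - f p * partial j g p) / g p ^+ 2.
Proof.
move=> df dg g0; rewrite partialM ?partialV //; first by field.
exact: differentiableV.
Qed.

Lemma partial_expR f j p : differentiable f p ->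
  partial j (fun x => expR (f x)) p = expR (f p) * partial j f p.
Proof.
move=> df.
have de : differentiable expR (f p).
  by apply/derivable1_diffP; exact: derivable_expR.
rewrite -[LHS]/('D_(delta_mx 0 j) (expR \o f) p) deriveE; last first.
  exact: differentiable_comp.
by rewrite diff_comp //= diff1E // derive1E derive_val /partial deriveE // mulrC.
Qed.

End OneDomain.
Lemma Ck_sum n k (U : set 'rV[R]_n) (I : Type) (r : seq I)
    (F : I -> 'rV[R]_n -> R) : open U ->
  (forall i, Ck k U (F i)) -> Ck k U (fun x => \sum_(i <- r) F i x).
Proof.
move=> oU CF; elim: r => [|i r IH].
  by apply: Ck_congr (Ck_cst k U 0) => // x _; rewrite big_nil.
by apply: Ck_congr (CkD oU (CF i) IH) => // x _; rewrite big_cons.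
Qed.

(** Induction on [k] for all [f] at once: by the chain rule a derivative of the composite is a sum
    of composites of partials of [f], which are one class lower, times partials of [s]. *)
Lemma Ck_comp m n k (W : set 'rV[R]_m) (U : set 'rV[R]_n) f s :
  open W -> (forall w, W w -> U (s w)) ->
  (forall i, Ck k W (component s i)) -> Ck k U f -> Ck k W (f \o s).
Proof.
move=> oW WU; elim: k f => [|k IH] f Cs Cf.
  move=> w Ww; apply: continuous_comp; last exact: (Cf _ (WU _ Ww)).
  by apply: continuous_component => i; exact: (Cs i _ Ww).
have ds w (Ww : W w) i : differentiable (component s i) w.
  by have [d _] := Cs i; exact: (d w Ww).
have df w (Ww : W w) : differentiable f (s w).
  by have [d _] := Cf; exact: (d _ (WU _ Ww)).
split=> [w Ww|j].
  by apply: differentiable_comp; [exact: differentiable_component (ds w Ww)|exact: df].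
have CS : Ck k W (fun w => \sum_i partial i f (s w) * partial j (component s i) w).
  apply: Ck_sum => // i; apply: CkM => //.
    by apply: IH => [l|]; [exact: CkW|have [_ pf] := Cf; exact: (pf i)].
  by have [_ ps] := Cs i; exact: (ps j).
by apply: Ck_congr CS => // w Ww; rewrite partial_comp //; [exact: df|exact: ds].
Qed.

Lemma smooth_comp m n (W : set 'rV[R]_m) (U : set 'rV[R]_n) f s :
  open W -> (forall w, W w -> U (s w)) ->
  smooth_map W s -> smooth U f -> smooth W (fun w => f (s w)).
Proof.
by move=> oW WU Ss Sf k; apply: Ck_comp WU _ (Sf k) => // i; exact: Ss.
Qed.

(** * Mean value theorem along lines and symmetry of second partial derivatives *)

Lemma is_derive_line (V : normedModType R) (f : V -> R) q v (s : R) :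
  derivable f (q + s *: v) v ->
  is_derive s 1 (fun s => f (q + s *: v)) ('D_v f (q + s *: v)).
Proof.
have E : (fun h => h^-1 *: (((fun s => f (q + s *: v)) \o shift s) (h *: 1)
    - f (q + s *: v)))
  = (fun h => h^-1 *: ((f \o shift (q + s *: v)) (h *: v) - f (q + s *: v))).
  apply/funext => h /=; rewrite [h *: 1]mulr1 scalerDl.
  by rewrite addrCA.
by move=> df; split; rewrite /derivable /derive E.
Qed.

Lemma MVT_line (V : normedModType R) (f : V -> R) q v :
  (forall s : R, 0 <= s <= 1 -> derivable f (q + s *: v) v) ->
  exists2 s : R, 0 <= s <= 1 & f (q + v) - f q = 'D_v f (q + s *: v).
Proof.
move=> df; pose g (s : R) := f (q + s *: v).
have dg (s : R) : 0 <= s <= 1 -> is_derive s 1 g ('D_v f (q + s *: v)).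
  by move=> s01; apply: is_derive_line; exact: df.
have [|||s s01 gE] := @MVT_segment R g (fun s => 'D_v f (q + s *: v)) 0 1.
- exact: ler01.
- by move=> s; rewrite in_itv /= => /andP[s0 s1]; apply: dg; rewrite !ltW.
- apply: derivable_within_continuous => s; rewrite in_itv /= => s01.
  by have [] := dg _ s01.
- exists s; first by move: s01; rewrite in_itv.
  by move: gE; rewrite /g scale1r scale0r addr0 subr0 mulr1.
Qed.

Lemma derive_scale n (f : 'rV[R]_n -> R) (h : R) j p : differentiable f p ->
  'D_(h *: delta_mx 0 j) f p = h * partial j f p.
Proof. by move=> df; rewrite /partial !deriveE // linearZ. Qed.

Lemma normr_delta n (j : 'I_n) : `|delta_mx 0 j : 'rV[R]_n| = 1.
Proof.
apply/eqP; rewrite eq_le; apply/andP; split.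
  rewrite [leLHS]mx_normrE; apply: bigmax_le => // -[i k] _.
  by rewrite mxE /=; case: (_ && _); rewrite ?normr0 ?normr1.
rewrite [leRHS]mx_normrE; apply: le_trans (le_bigmax _ _ (0, j)).
by rewrite mxE /= !eqxx normr1.
Qed.

Section Schwarz.
Context {n : nat}.
Implicit Types (U : set 'rV[R]_n) (f : 'rV[R]_n -> R).

Lemma partial_translate f (c p : 'rV[R]_n) j :
  partial j (fun x => f (x + c)) p = partial j f (p + c).
Proof.
rewrite /partial /derive; set v := delta_mx 0 j.
suff -> : (fun h : R => h^-1 *: (((fun x => f (x + c)) \o shift p) (h *: v) - f (p + c)))
  = (fun h => h^-1 *: ((f \o shift (p + c)) (h *: v) - f (p + c))) by [].
by apply/funext => h /=; rewrite addrA.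
Qed.

(** Two mean value steps: the increment of [f] along [j] is differenced along [i], which leaves an
    increment of [partial i f] along [j]. The second difference on the left is symmetric in [i] and
    [j], the derivative on the right is not visibly so. *)
Lemma second_difference f (p : 'rV[R]_n) (i j : 'I_n) (h : R) :
  0 < h -> (forall x : 'rV[R]_n, `|p - x| <= h + h -> differentiable f x) ->
  (forall x : 'rV[R]_n, `|p - x| <= h + h -> differentiable (partial i f) x) ->
  exists2 x, `|p - x| <= h + h &
  f (p + h *: delta_mx 0 i + h *: delta_mx 0 j) - f (p + h *: delta_mx 0 i)
   - f (p + h *: delta_mx 0 j) + f p = h * (h * partial j (partial i f) x).
Proof.
move=> h0 df dfi; set ei := delta_mx 0 i; set ej := delta_mx 0 j.
have near_p (s t : R) : 0 <= s <= h -> 0 <= t <= h ->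
    `|p - (p + s *: ei + t *: ej)| <= h + h.
  move=> /andP[s0 sh] /andP[t0 th].
  rewrite -addrA opprD addrA subrr add0r normrN (le_trans (ler_normD _ _)) //.
  by rewrite !normrZ !normr_delta !mulr1 !ger0_norm // lerD.
have hs (s : R) : 0 <= s <= 1 -> 0 <= s * h <= h.
  by move=> /andP[s0 s1]; rewrite mulr_ge0 ?(ltW h0) // ger_pMl.
have h1 : 0 <= h <= h by rewrite lexx ltW.
have h2 : 0 <= (0 : R) <= h by rewrite lexx ltW.
pose A (x : 'rV[R]_n) := f (x + h *: ej) - f x.
have dA (s : R) : 0 <= s <= 1 -> differentiable A (p + s *: (h *: ei)).
  move=> s01; rewrite scalerA; apply: differentiableB; last first.
    apply: df; have := near_p _ _ (hs s s01) h2; by rewrite scale0r addr0.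
  apply: (@differentiable_comp _ _ _ _ (fun x => x + h *: ej) f).
    by apply: differentiableD => //; exact: differentiable_cst.
  by apply: df; exact: near_p (hs s s01) h1.
have [s s01 sE] := MVT_line (fun s s01 => diff_derivable (v := h *: ei) (dA s s01)).
rewrite (derive_scale _ _ (dA s s01)) in sE.
have sh := hs s s01.
have dpE : partial i A (p + s *: (h *: ei)) =
    partial i f (p + (s * h) *: ei + h *: ej) - partial i f (p + (s * h) *: ei).
  rewrite scalerA; set x := p + _.
  rewrite partialB.
  - by rewrite partial_translate.
  - apply: (@differentiable_comp _ _ _ _ (fun x => x + h *: ej) f).
      by apply: differentiableD => //; exact: differentiable_cst.
    by apply: df; exact: near_p sh h1.
  - by apply: df; have := near_p _ _ sh h2; rewrite scale0r addr0.
have dfi' (t : R) : 0 <= t <= 1 ->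
    differentiable (partial i f) (p + (s * h) *: ei + t *: (h *: ej)).
  by move=> t01; rewrite scalerA; apply: dfi; exact: near_p sh (hs t t01).
have [t t01 tE] := MVT_line (fun t t01 => diff_derivable (v := h *: ej) (dfi' t t01)).
rewrite (derive_scale _ _ (dfi' t t01)) in tE.
exists (p + (s * h) *: ei + t *: (h *: ej)).
  by rewrite scalerA; exact: near_p sh (hs t t01).
by rewrite -tE -dpE -sE /A; ring.
Qed.

Lemma partialC U f p (i j : 'I_n) : open U -> Ck 2 U f -> U p ->
  partial i (partial j f) p = partial j (partial i f) p.
Proof.
move=> oU [df pf] Up; apply/eqP; rewrite -subr_eq0 -normr_le0.
apply/ler_addgt0Pl => e e0; rewrite addr0.
have e2 : 0 < e / 2 by rewrite divr_gt0.
have cij k l : {for p, continuous (partial k (partial l f))}.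
  by have [_ /(_ k) ppf] := pf l; exact: (ppf p Up).
have near_pij k l : \forall x \near p,
    `|partial k (partial l f) p - partial k (partial l f) x| < e / 2.
  by have /cvgrPdist_lt/(_ _ e2) := cij k l.
have nU : \forall x \near p, U x by exact: open_nbhs_nbhs.
have [d d0 dB] := near_norm (near_and nU (near_and (near_pij i j) (near_pij j i))).
(* With this step the points produced by the second differences stay within [d / 4 + d / 4],
   strictly inside the radius [d]. *)
have h0 : 0 < d / 4 by rewrite divr_gt0.
have hB (x : 'rV[R]_n) : `|p - x| <= d / 4 + d / 4 -> `|p - x| < d.
  by move=> H; apply: le_lt_trans H _; lra.
have dfU x : `|p - x| <= d / 4 + d / 4 -> differentiable f x.
  by move=> /hB/dB[Ux _]; exact: (df x Ux).
have dpU k x : `|p - x| <= d / 4 + d / 4 -> differentiable (partial k f) x.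
  by move=> /hB/dB[Ux _]; have [dk _] := pf k; exact: (dk x Ux).
have [x /hB/dB[_ [_ x2]] xE] := @second_difference f p i j _ h0 dfU (dpU i).
have [y /hB/dB[_ [y1 _]] yE] := @second_difference f p j i _ h0 dfU (dpU j).
(* Both second differences are the same number, so the two mixed derivatives agree at the two nearby
   points [x] and [y]; continuity carries this to [p]. *)
have xy : partial j (partial i f) x = partial i (partial j f) y.
  apply: (mulfI (lt0r_neq0 h0)); apply: (mulfI (lt0r_neq0 h0)).
  refine (etrans (esym xE) (etrans _ yE)); set a := f (_ + _ + _); set b := f (_ + _ + _).
  have -> : a = b by congr f; exact: addrAC.
  by move: b (f _) (f _) (f _) => b c1 c2 c3; ring.
by rewrite xy in x2; exact: ler_dist_half y1 x2.
Qed.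

End Schwarz.

End SmoothCalculus.

(** Provides the join of the complete and the normed structure on row vectors, over which the Banach
    fixed point theorem is stated. *)
HB.instance Definition _ (R : realType) n := Complete.on 'rV[R]_n.

(** * The inverse function theorem on row vectors *)

Section InverseFunction.
Context {R : realType}.

Lemma diff_eps (V W : normedModType R) (f : V -> W) (p : V) (e : R) :
  differentiable f p -> 0 < e ->
  exists2 d, 0 < d &
    forall x, `|p - x| < d -> `|f x - f p - 'd f p (x - p)| <= e * `|x - p|.
Proof.
move=> df e0; have /diff_locally/eqaddoP/(_ e e0) := df.
move=> /near_norm[d d0 dP]; exists d => // x px.
have /dP : `|0 - (x - p)| < d by rewrite sub0r opprB.
rewrite -[X in `|X| <= _ -> _]/(f (x - p + p) - (f p + 'd f p (x - p))).
by rewrite subrK opprD addrA.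
Qed.

Lemma eps_diff (V W : normedModType R) (f : V -> W) (L : {linear V -> W}) (p : V) :
  continuous L ->
  (forall e, 0 < e -> exists2 d, 0 < d &
    forall x, `|p - x| < d -> `|f x - f p - L (x - p)| <= e * `|x - p|) ->
  differentiable f p /\ 'd f p = L :> (V -> W).
Proof.
move=> cL H; apply: (differentiable_eps cL) => e e0; have [d d0 dP] := H e e0.
apply/nbhs_ballP; exists d => //= h; rewrite -ball_normE /= sub0r normrN => hd.
have /dP : `|p - (h + p)| < d by rewrite opprD addrCA subrr addr0 normrN.
by rewrite addrK.
Qed.

Lemma open_norm (V : normedModType R) (U : set V) p : open U -> U p ->
  exists2 d : R, 0 < d & forall x, `|p - x| < d -> U x.
Proof. by move=> oU Up; apply: near_norm; exact: open_nbhs_nbhs. Qed.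

Lemma norm_open (V : normedModType R) (U : set V) :
  (forall p, U p -> exists2 d : R, 0 < d & forall x, `|p - x| < d -> U x) ->
  open U.
Proof.
move=> H; rewrite openE => p /H[d d0 dP].
by apply/nbhs_ballP; exists d => //= x; rewrite -ball_normE; exact: dP.
Qed.

Lemma ball_convex (V : normedModType R) (a x y : V) (d s : R) :
  `|a - x| < d -> `|a - y| < d -> 0 <= s <= 1 ->
  `|a - (x + s *: (y - x))| < d.
Proof.
move=> ax ay /andP[s0 s1].
have -> : a - (x + s *: (y - x)) = (1 - s) *: (a - x) + s *: (a - y).
  rewrite scalerBl scale1r !scalerBr opprD !opprB addrA -!addrA; congr (_ + _).
  congr (_ + _); rewrite addrCA [RHS]addrCA; congr (_ + _).
  by rewrite addrA addNr add0r.
rewrite (le_lt_trans (ler_normD _ _)) // !normrZ !ger0_norm ?subr_ge0 //.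
have [->|s0'] := eqVneq s 0; first by rewrite mul0r subr0 mul1r addr0.
have -> : d = (1 - s) * d + s * d by ring.
rewrite ler_ltD // ?ler_wpM2l ?subr_ge0 ?(ltW ax) //.
by rewrite ltr_pM2l // lt_def s0'.
Qed.

Section Space.
Context {n : nat}.
Implicit Types (f : 'rV[R]_n -> R) (x y v w : 'rV[R]_n) (Phi : 'rV[R]_n -> 'rV[R]_n).

Lemma normr_coord x i : `|x 0 i| <= `|x|.
Proof.
by rewrite [leRHS]mx_normrE; exact: (le_trans _ (le_bigmax _ _ (0, i))).
Qed.

Lemma normr_le_coord x c : 0 <= c -> (forall i, `|x 0 i| <= c) -> `|x| <= c.
Proof.
move=> c0 xc; rewrite [leLHS]mx_normrE; apply: bigmax_le => // -[i j] _ /=.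
by rewrite (ord1 i).
Qed.

Lemma derive_partial f p v : differentiable f p ->
  'D_v f p = \sum_i v 0 i * partial i f p.
Proof.
move=> df; rewrite deriveE // [in LHS](rV_basis v) linear_sum /=.
by apply: eq_bigr => i _; rewrite linearZ /= /partial deriveE.
Qed.

(** Mean value theorem on the segment, which stays in the convex ball. In the sup norm each of the
    [n] coordinates of the increment is bounded by its norm, hence the factor [n]. *)
Lemma lipschitz_partial f a d c :
  (forall x, `|a - x| < d -> differentiable f x) ->
  (forall x i, `|a - x| < d -> `|partial i f x| <= c) ->
  forall x y, `|a - x| < d -> `|a - y| < d -> `|f y - f x| <= n%:R * c * `|y - x|.
Proof.
move=> df pf x y ax ay.
have seg (s : R) : 0 <= s <= 1 -> `|a - (x + s *: (y - x))| < d.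
  by move=> s01; exact: ball_convex.
have [s s01] := MVT_line (fun s s01 => diff_derivable (v := y - x) (df _ (seg s s01))).
rewrite (addrC x (y - x)) subrK => ->; rewrite derive_partial; last exact: df (seg s s01).
rewrite (le_trans (ler_norm_sum _ _ _)) //.
rewrite (@le_trans _ _ (\sum_(i < n) c * `|y - x|)) //.
  apply: ler_sum => i _; rewrite normrM mulrC.
  by rewrite ler_pM // ?normr_coord // pf // seg.
by rewrite sumr_const card_ord -(mulr_natl (c * _)) mulrA.
Qed.

(** Transpose of the usual Jacobian matrix: vectors are rows, so the differential is multiplication
    on the right and the chain rule lists the factors in the order of application. *)
Definition jacmx Phi x : 'M[R]_n :=
  \matrix_(i, j) partial i (component Phi j) x.

Lemma diff_jacmx Phi x v : differentiable Phi x ->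
  (forall i, differentiable (component Phi i) x) ->
  'd Phi x v = v *m jacmx Phi x.
Proof.
move=> dP dPi; apply/rowP => j; rewrite mxE -deriveE // derive_mx; last first.
  exact: diff_derivable.
rewrite mxE /=; have := derive_partial v (dPi j); rewrite /component => ->.
by apply: eq_bigr => i _; rewrite mxE.
Qed.

Lemma smooth_mulmx U (A : 'M[R]_n) : open U -> smooth_map U (fun x => x *m A).
Proof.
move=> oU i k.
apply: (Ck_congr (f := fun x => \sum_j x 0 j * A j i)) => // [x _|].
  by rewrite /component mxE.
by apply: Ck_sum => // j; apply: CkM => //; [exact: Ck_coord|exact: Ck_cst].
Qed.

Lemma continuous_mulmx (A : 'M[R]_n) : continuous (fun x : 'rV[R]_n => x *m A).
Proof.
move=> x; apply: continuous_component => i.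
exact: (smooth_continuous (smooth_mulmx A openT i)).
Qed.

Lemma mulmx_bound (A : 'M[R]_n) :
  exists2 c, 0 < c & forall x : 'rV[R]_n, `|x *m A| <= c * `|x|.
Proof.
have cA : continuous (mulmxr A : {linear 'rV[R]_n -> 'rV[R]_n}) := @continuous_mulmx A.
by have [c c0 H] := linear_lipschitz cA; exists c.
Qed.

Lemma Ck_prod k (U : set 'rV[R]_n) (I : Type) (r : seq I)
    (F : I -> 'rV[R]_n -> R) : open U ->
  (forall i, Ck k U (F i)) -> Ck k U (fun x => \prod_(i <- r) F i x).
Proof.
move=> oU CF; elim: r => [|i r IH].
  by apply: Ck_congr (Ck_cst k U 1) => // x _; rewrite big_nil.
by apply: Ck_congr (CkM oU (CF i) IH) => // x _; rewrite big_cons.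
Qed.

Lemma smooth_det m (U : set 'rV[R]_n) (A : 'rV[R]_n -> 'M[R]_m) : open U ->
  (forall i j, smooth U (fun x => A x i j)) -> smooth U (fun x => \det (A x)).
Proof.
move=> oU SA k; apply: Ck_sum => // s; apply: CkM => //; first exact: Ck_cst.
by apply: Ck_prod => // i; exact: SA.
Qed.

(** Cramer's rule: the entries of the inverse are cofactors divided by the determinant. *)
Lemma smooth_invmx (U : set 'rV[R]_n) (A : 'rV[R]_n -> 'M[R]_n) : open U ->
  (forall x, U x -> \det (A x) != 0) ->
  (forall i j, smooth U (fun x => A x i j)) ->
  forall i j, smooth U (fun x => invmx (A x) i j).
Proof.
move=> oU detA SA i j.
have S : smooth U (fun x => (\det (A x))^-1 * ((-1) ^+ (j + i) *
    \det (row' j (col' i (A x))))).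
  apply: smoothM => //; first by apply: smoothV => //; exact: smooth_det.
  apply: smoothM => //; first exact: smooth_cst.
  apply: smooth_det => // k l.
  apply: smooth_congr (SA (lift j k) (lift i l)) => // x _.
  by rewrite !mxE.
apply: smooth_congr S => // x Ux.
by rewrite /invmx unitmxE unitfE detA // !mxE.
Qed.

Lemma partial_sum (I : finType) (F : I -> 'rV[R]_n -> R) x j :
  (forall i, differentiable (F i) x) ->
  partial j (fun y => \sum_i F i y) x = \sum_i partial j (F i) x.
Proof.
move=> dF; suff [_ ->] : differentiable (fun y => \sum_i F i y) x /\
    partial j (fun y => \sum_i F i y) x = \sum_i partial j (F i) x by [].
elim: (index_enum I) => [|i r [dr IH]].
  have -> : (fun y => \sum_(i <- [::]) F i y) = (fun _ : 'rV[R]_n => 0).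
    by apply/funext => y; rewrite big_nil.
  by rewrite big_nil partial_cst; split.
have -> : (fun y => \sum_(i <- i :: r) F i y) =
    (fun y => F i y + \sum_(i <- r) F i y).
  by apply/funext => y; rewrite big_cons.
rewrite big_cons partialD // IH; split=> //; exact: (differentiableD (dF i) dr).
Qed.

Lemma component_differentiable Phi x i :
  differentiable Phi x -> differentiable (component Phi i) x.
Proof.
move=> dP; apply: (@differentiable_comp _ _ _ _ Phi (fun y : 'rV[R]_n => y 0 i)) => //.
exact: differentiable_coord.
Qed.

Lemma jacmx_comp Phi (s : 'rV[R]_n -> 'rV[R]_n) w :
  (forall i, differentiable (component Phi i) (s w)) ->
  (forall i, differentiable (component s i) w) ->
  jacmx (Phi \o s) w = jacmx s w *m jacmx Phi (s w).
Proof.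
move=> dP ds; apply/matrixP => j i; rewrite !mxE.
rewrite -[LHS]/(partial j (component Phi i \o s) w) partial_comp //.
by apply: eq_bigr => l _; rewrite !mxE mulrC.
Qed.

(** A contraction of ratio 1/2 that moves the centre of a closed ball by at most half the radius
    maps the ball into itself. The translation [z] is kept apart because the target point of the
    equation to be solved enters only there. *)
Lemma fixed_point_in_ball (psi : 'rV[R]_n -> 'rV[R]_n) x0 z e : 0 <= e ->
  (forall x y, `|x0 - x| <= e -> `|x0 - y| <= e ->
     `|psi x - psi y| <= 2^-1 * `|x - y|) ->
  `|x0 - (psi x0 + z)| <= e / 2 ->
  exists2 x, `|x0 - x| <= e & x = psi x + z.
Proof.
move=> e0 cpsi z0; pose B := [set x | `|x0 - x| <= e].
have x0B : B x0 by rewrite /B /= subrr normr0.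
have TB : set_fun B B (fun x => psi x + z).
  move=> x Bx; rewrite /B /= -(subrKA (psi x0 + z)).
  rewrite (splitr e) (le_trans (ler_normD _ _)) //; apply: lerD; first exact: z0.
  rewrite opprD addrACA subrr addr0 (le_trans (cpsi _ _ x0B Bx)) // mulrC ler_pM2r ?invr_gt0 //.
have cl : closed B.
  have -> : B = closed_ball_ (fun x : 'rV[R]_n => `|x|) x0 e by [].
  exact: closed_closed_ball_.
have ctr : is_contraction (mkfun_fun TB).
  exists (2^-1)%:nng; split => /=; first by rewrite invf_lt1 ?ltr1n.
  by move=> [x y] /= [Bx By]; rewrite opprD addrACA subrr addr0; exact: cpsi.
have [x Bx xE] := @banach_fixed_point R 'rV[R]_n B (mkfun_fun TB) ctr cl
  (ex_intro _ x0 x0B).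
by exists x.
Qed.

(** The map is the Newton map of [Phi] with the inverse Jacobian frozen at [w0]. Its derivative
    vanishes at [w0], so its partials are small nearby. *)
Lemma local_contraction W Phi w0 : open W -> smooth_map W Phi -> W w0 ->
  \det (jacmx Phi w0) != 0 ->
  exists d, [/\ 0 < d,
    forall x, `|w0 - x| < d -> W x /\ \det (jacmx Phi x) != 0 &
    forall x y, `|w0 - x| < d -> `|w0 - y| < d ->
      `|(x - Phi x *m invmx (jacmx Phi w0)) -
        (y - Phi y *m invmx (jacmx Phi w0))| <= 2^-1 * `|x - y|].
Proof.
move=> oW SP Ww0 J0; set A := invmx _.
pose psi k x := x 0 k - \sum_j component Phi j x * A j k.
have Spsi k : smooth W (psi k).
  move=> l; apply: (smoothB oW (@smooth_coord _ _ W k) _ l) => {}l.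
  apply: Ck_sum => // j; apply: CkM => //; first exact: SP.
  exact: Ck_cst.
have dpsi0 i k : partial i (psi k) w0 = 0.
  have dP j : differentiable (component Phi j) w0.
    exact: smooth_differentiable (SP j) Ww0.
  have dPA j : differentiable (fun x => component Phi j x * A j k) w0.
    by apply: (differentiableM (dP j)); exact: differentiable_cst.
  rewrite partialB; [|exact: differentiable_coord|]; last first.
    have : smooth W (fun x => \sum_j component Phi j x * A j k).
      move=> l; apply: Ck_sum => // j; apply: CkM => //; first exact: SP.
      exact: Ck_cst.
    by move/smooth_differentiable; apply.
  rewrite partial_coord partial_sum // (eq_bigr (fun j => jacmx Phi w0 i j * A j k)).
    have /matrixP/(_ i k) : jacmx Phi w0 *m A = 1%:M.
      by rewrite mulmxV // unitmxE unitfE.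
    by rewrite !mxE eq_sym => ->; rewrite subrr.
  move=> j _; rewrite partialM // partial_cst mulr0 addr0; congr (_ * _).
  by rewrite mxE.
(* Chosen so that [n * c] is at most 1/2 in [lipschitz_partial]; [n.+1] instead of [n] avoids a
   division by zero in dimension 0. *)
pose c : R := (2 * n.+1%:R)^-1.
have c0 : 0 < c by rewrite invr_gt0 mulr_gt0.
have near_psi : \forall x \near w0, forall ik : 'I_n * 'I_n,
    `|partial ik.1 (psi ik.2) x| <= c.
  suff nf (ik : 'I_n * 'I_n) : \forall x \near w0, `|partial ik.1 (psi ik.2) x| <= c.
    exact: (@filter_forall _ _ (fun ik x => `|partial ik.1 (psi ik.2) x| <= c) (nbhs w0)).
  case: ik => i k /=.
  have := smooth_continuous (smooth_partial i (Spsi k)) Ww0.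
  move=> /cvgrPdist_le/(_ _ c0); rewrite dpsi0 => H.
  by apply: filterS H => x; rewrite sub0r normrN.
have Sdet : smooth W (fun x => \det (jacmx Phi x)).
  apply: smooth_det => // i j.
  apply: smooth_congr (smooth_partial i (SP j)) => // x _; by rewrite mxE.
have near_det : \forall x \near w0, \det (jacmx Phi x) != 0.
  have := smooth_continuous Sdet Ww0 => cd.
  exact: (@cvgr_neq0 _ _ _ (nbhs w0) _ _ _ cd J0).
have nW : \forall x \near w0, W x by exact: open_nbhs_nbhs.
have [d d0 dP] := near_norm (near_and nW (near_and near_det near_psi)).
exists d; split => // [x /dP[Wx [Jx _]]//|x y dx dy].
apply: normr_le_coord => [|k]; first by rewrite mulr_ge0 ?invr_ge0.
have psiE z : psi k z = (z - Phi z *m A) 0 k by rewrite !mxE.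
have -> : ((x - Phi x *m A) - (y - Phi y *m A)) 0 k = psi k x - psi k y.
  by rewrite !psiE !mxE.
have L := @lipschitz_partial (psi k) w0 d c _ _ y x dy dx.
apply: le_trans (L _ _) _.
- by move=> z /dP[Wz _]; exact: smooth_differentiable (Spsi k) Wz.
- by move=> z i /dP[_ [_ /(_ (i, k))]].
rewrite ler_wpM2r // /c invfM mulrCA ler_piMr ?invr_ge0 //.
by rewrite ler_pdivrMr // mul1r ler_nat.
Qed.

(** The contraction estimate yields a lower bound for the distances between values of [Phi]
    ([expand]), hence injectivity and a Lipschitz inverse. Images of open sets are open because Phi
    x = y is a fixed point problem for the translated Newton map, and the Lipschitz bound makes the
    inverse differentiable. *)
Lemma inverse_function W Phi w0 : open W -> smooth_map W Phi -> W w0 ->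
  \det (jacmx Phi w0) != 0 ->
  exists W0 Om (sigma : 'rV[R]_n -> 'rV[R]_n), 
    [/\ open W0 /\ open Om, W0 w0 /\ W0 `<=` W,
      forall x, W0 x -> [/\ Om (Phi x), sigma (Phi x) = x & \det (jacmx Phi x) != 0],
      forall y, Om y -> W0 (sigma y) /\ Phi (sigma y) = y
    & smooth_map Om sigma].
Proof.
move=> oW SP Ww0 J0.
have [d [d0 BW cA]] := local_contraction oW SP Ww0 J0.
move: cA; set A := invmx _ => cA.
have AU : A \in unitmx by rewrite unitmx_inv unitmxE unitfE.
have [c c0 cP] := mulmx_bound A.
pose B := [set x | `|w0 - x| < d].
have oB : open B.
  apply: norm_open => p Bp; exists (d - `|w0 - p|); first by rewrite subr_gt0.
  move=> x px; rewrite /B /= -(subrKA p) (le_lt_trans (ler_normD _ _)) //.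
  by rewrite -ltrBrDl.
have expand x y : B x -> B y -> `|x - y| <= 2 * c * `|Phi x - Phi y|.
  move=> Bx By; have := cA x y Bx By.
  have -> : x - Phi x *m A - (y - Phi y *m A) = (x - y) - (Phi x - Phi y) *m A.
    by rewrite mulmxBl (opprD y) (opprD (Phi x *m A)) addrACA.
  move=> H1; have H2 := cP (Phi x - Phi y); have H3 := ler_normD (x - y - (Phi x - Phi y) *m A) ((Phi x - Phi y) *m A).
  rewrite subrK in H3.
  lra.
have openB (O : set 'rV[R]_n) : open O -> O `<=` B -> open (Phi @` O).
  move=> oO OB; apply: norm_open => _ [x0 Ox0 <-].
  have [e e0 eO] := open_norm oO Ox0.
  have e2 : 0 < e / 2 by rewrite divr_gt0.
  (* The contraction principle is applied on the closed ball of radius [e / 2], which lies in the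
     open ball of radius [e]. Its centre may move by half that radius, and [c] accounts for the
     multiplication by [A]. *)
  exists (e / 2 / 2 / c); first by rewrite !divr_gt0.
  move=> y yP.
  have [||x xe xE] := @fixed_point_in_ball (fun x => x - Phi x *m A) x0 (y *m A) _ (ltW e2).
  - move=> u v ue ve; apply: cA; apply: OB; apply: eO;
      [apply: le_lt_trans ue _|apply: le_lt_trans ve _];
      by rewrite ltr_pdivrMr // ltr_pMr // ltr1n.
  - have -> : x0 - (x0 - Phi x0 *m A + y *m A) = (Phi x0 - y) *m A.
      by rewrite mulmxBl opprD opprB addrA addrCA subrr addr0.
    rewrite (le_trans (cP _)) // mulrC -ler_pdivlMr //; exact: ltW.
  exists x; first by apply: eO; apply: le_lt_trans xe _; rewrite ltr_pdivrMr // ltr_pMr // ltr1n.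
  have : Phi x *m A = y *m A.
    apply/eqP; rewrite -subr_eq0; apply/eqP.
    have : x - (x - Phi x *m A + y *m A) = 0 by rewrite -xE subrr.
    by rewrite opprD opprB addrA addrCA subrr addr0.
  by move=> /(congr1 (mulmx^~ (invmx A))); rewrite !mulmxK.
(* The default [w0] is taken only outside the image of [B], where nothing is claimed about
   [sigma]. *)
pose sigma y := xget w0 [set x | B x /\ Phi x = y].
have sP y : (Phi @` B) y -> B (sigma y) /\ Phi (sigma y) = y.
  move=> [x Bx xy]; rewrite /sigma; case: xgetP => [_ _ //|].
  by move=> /(_ x); case; split.
have sK x : B x -> sigma (Phi x) = x.
  move=> Bx; have [|Bs Es] := sP (Phi x); first by exists x.
  have := expand _ _ Bs Bx; rewrite Es subrr normr0 mulr0 normr_le0 subr_eq0.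
  by move/eqP.
have JU x : B x -> jacmx Phi x \in unitmx.
  by move=> /BW[_]; rewrite unitmxE unitfE.
have oOm : open (Phi @` B) by exact: openB.
have dPhi x : B x -> differentiable Phi x /\ forall i, differentiable (component Phi i) x.
  move=> /BW[Wx _]; have di i := smooth_differentiable (SP i) Wx.
  by split => //; exact: differentiable_component.
have ds y : (Phi @` B) y -> differentiable sigma y /\
    jacmx sigma y = invmx (jacmx Phi (sigma y)).
  move=> Oy; have [Bs Es] := sP y Oy; set x := sigma y in Bs Es *.
  have [dPx dPix] := dPhi x Bs.
  set J := jacmx Phi x.
  have JJ : J \in unitmx by exact: JU.
  have [c1 c10 c1P] := mulmx_bound (invmx J).
  have cL : continuous (mulmxr (invmx J) : {linear 'rV[R]_n -> 'rV[R]_n}).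
    exact: @continuous_mulmx (invmx J).
  have dsy : differentiable sigma y.
    suff [] : differentiable sigma y /\ 'd sigma y = mulmxr (invmx J) :> ('rV[R]_n -> 'rV[R]_n) by [].
    apply: (eps_diff cL) => e e0.
    have [d2 d20 d2P] := open_norm oOm Oy.
    (* [c1] bounds multiplication by the inverse Jacobian and [2 * c] is the Lipschitz constant of
       [sigma]; both are divided out in advance. *)
    have e'0 : 0 < e / (c1 * (2 * c)) by rewrite divr_gt0 // !mulr_gt0.
    have [d1 d10 d1P] := diff_eps dPx e'0.
    have d1c : 0 < d1 / (2 * c) by rewrite divr_gt0 // mulr_gt0.
    exists (Num.min d2 (d1 / (2 * c))); first by rewrite lt_min d20 d1c.
    move=> y'; rewrite lt_min => /andP[/d2P Oy' yy'] /=.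
    have [Bs' Es'] := sP y' Oy'; set x' := sigma y' in Bs' Es' *.
    have lip : `|x' - x| <= 2 * c * `|y' - y|.
      by rewrite -Es' -Es; exact: expand.
    have xx' : `|x - x'| < d1.
      rewrite distrC (le_lt_trans lip) // mulrC -ltr_pdivlMr ?mulr_gt0 //.
      by rewrite distrC.
    have := d1P x' xx'; rewrite diff_jacmx // Es' Es -/J => bnd.
    rewrite -/x.
    have -> : x' - x - (y' - y) *m invmx J =
        - ((y' - y - (x' - x) *m J) *m invmx J).
      by rewrite (mulmxBl (y' - y)) mulmxK // opprB.
    rewrite normrN (le_trans (c1P _)) //.
    rewrite (@le_trans _ _ (c1 * (e / (c1 * (2 * c)) * (2 * c * `|y' - y|)))) //.
      rewrite ler_pM2l // (le_trans bnd) // ler_pM2l //.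
    rewrite le_eqVlt; apply/orP; left; apply/eqP; field.
    by rewrite !gt_eqF.
  split=> //.
  have dsi i : differentiable (component sigma i) y by exact: component_differentiable.
  have E : jacmx sigma y *m J = 1%:M.
    rewrite /J -jacmx_comp //; apply/matrixP => j i; rewrite !mxE.
    rewrite (@partial_congr _ _ _ _ (fun z : 'rV[R]_n => z 0 i) _ _ oOm _ Oy).
      by rewrite partial_coord eq_sym.
    by move=> z /sP[_ Ez]; rewrite /component /= Ez.
  by rewrite -[LHS](mulmxK JJ) E mul1mx.
exists B, (Phi @` B), sigma; split => //.
- by split; [rewrite /B /= subrr normr0|move=> x /BW[]].
- by move=> x Bx; split; [exists x|exact: sK|have [] := BW x Bx].
(* Bootstrapping: the partials of [sigma] are entries of the inverse Jacobian of [Phi] composed with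
   [sigma], so if [sigma] is C^k then so are its partials. *)
- move=> i k; elim: k i => [|k IH] i.
    move=> y /ds[dsy _]; apply: (@differentiable_continuous _ _ _ y (component sigma i)).
    exact: component_differentiable.
  split=> [y /ds[dsy _]|j]; first exact: component_differentiable.
  have SJ : smooth B (fun x => invmx (jacmx Phi x) j i).
    apply: smooth_invmx => // [x /BW[]//|l m].
    apply: (smooth_congr (f := partial l (component Phi m))) => // [x _|].
      by rewrite mxE.
    by apply/smooth_partial/(smooth_sub _ (SP m)) => x /BW[].
  apply: Ck_congr (Ck_comp oOm _ IH (SJ k)) => // y Oy; last by have [] := sP y Oy.
  by have [_ /matrixP/(_ j i)] := ds y Oy; rewrite mxE => ->.
Qed.

End Space.
End InverseFunction.

(** * Local potentials of closed 1-forms in the plane *)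

Section Poincare.
Context {R : realType}.

Lemma antiderivative (f : R -> R) (c d : R) : c < d ->
  (forall x, c <= x <= d -> {for x, continuous f}) ->
  exists F : R -> R, forall x, c < x < d -> is_derive x 1 F (f x).
Proof.
move=> cd cf; exists (fun x => \int[lebesgue_measure]_(t in `[c, x]) f t)%R.
move=> x /andP[cx xd].
have cfw : {within `[c, d], continuous f}.
  apply: continuous_in_subspaceT => t; rewrite inE /= in_itv /=; exact: cf.
have fint := continuous_compact_integrable (@segment_compact R c d) cfw.
have cfx : {for x, continuous f} by apply: cf; rewrite !ltW.
have [dF FE] := continuous_FTC1_closed xd fint cx cfx.
split; first exact: dF.
exact: (etrans (esym (derive1E _ _)) FE).
Qed.

(** Mean value theorem without an order on the endpoints. Besides the interval, only the distance
    from [z] to [x] is recorded, which is what a Lipschitz estimate around [x] consumes. *)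
Lemma MVT_between (g dg : R -> R) (l u x y : R) :
  (forall z, l < z < u -> is_derive z 1 g (dg z)) -> l < x < u -> l < y < u ->
  exists z, [/\ l < z < u, `|z - x| <= `|y - x| & g y - g x = dg z * (y - x)].
Proof.
move=> Dg xlu ylu.
have main (a b : R) : a <= b -> l < a < u -> l < b < u ->
    exists z, [/\ l < z < u, a <= z <= b & g b - g a = dg z * (b - a)].
  move=> ab /andP[la au] /andP[lb bu].
  have Dab z : a <= z <= b -> is_derive z 1 g (dg z).
    by move=> /andP[az zb]; apply: Dg; rewrite (lt_le_trans la az) (le_lt_trans zb bu).
  have [||z] := @MVT_segment R g dg a b ab.
  - by move=> z; rewrite in_itv /= => /andP[az zb]; apply: Dab; rewrite !ltW.
  - apply: derivable_within_continuous => z; rewrite in_itv /= => zab.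
    by have [] := Dab _ zab.
  rewrite in_itv /= => /andP[az zb] E; exists z; rewrite az zb.
  by rewrite (lt_le_trans la az) (le_lt_trans zb bu).
have [xy|yx] := leP x y.
  have [z [zlu /andP[xz zy] E]] := main x y xy xlu ylu; exists z; split=> //.
  by rewrite !ger0_norm ?subr_ge0 // lerD2r.
have [z [zlu /andP[yz zx] E]] := main y x (ltW yx) ylu xlu; exists z; split=> //.
  by rewrite !ler0_norm ?subr_le0 ?(ltW yx) // lerN2 lerD2r.
by rewrite -(opprB x y) mulrN -E opprB.
Qed.

Definition plane_point (a b : R) : 'rV[R]_2 := a *: delta_mx 0 0 + b *: delta_mx 0 1.

Lemma plane_point0 a b : plane_point a b 0 0 = a.
Proof. by rewrite !mxE /= mulr1 mulr0 addr0. Qed.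

Lemma plane_point1 a b : plane_point a b 0 1 = b.
Proof. by rewrite !mxE /= mulr1 mulr0 add0r. Qed.

Lemma ord2 (i : 'I_2) : i = 0 \/ i = 1.
Proof. by case: i => [[|[|//]] Hi]; [left|right]; apply: val_inj. Qed.

Lemma plane_pointE (x : 'rV[R]_2) : plane_point (x 0 0) (x 0 1) = x.
Proof.
by apply/rowP => i; case: (ord2 i) => ->; rewrite ?plane_point0 ?plane_point1.
Qed.

Lemma slice0 (f : 'rV[R]_2 -> R) a b : differentiable f (plane_point a b) ->
  is_derive a 1 (fun a => f (plane_point a b)) (partial 0 f (plane_point a b)).
Proof.
move=> df; have E : (fun a => f (plane_point a b)) =
    (fun s => f (b *: delta_mx 0 1 + s *: delta_mx 0 0)).
  by apply/funext => s; rewrite /plane_point addrC.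
rewrite E /partial /plane_point addrC; apply: is_derive_line.
by apply: diff_derivable; rewrite addrC.
Qed.

Lemma slice1 (f : 'rV[R]_2 -> R) a b : differentiable f (plane_point a b) ->
  is_derive b 1 (fun b => f (plane_point a b)) (partial 1 f (plane_point a b)).
Proof.
by move=> df; apply: is_derive_line; exact: diff_derivable.
Qed.

Lemma norm_plane_point (x : 'rV[R]_2) a b c : 0 <= c ->
  `|x 0 0 - a| <= c -> `|x 0 1 - b| <= c -> `|x - plane_point a b| <= c.
Proof.
move=> c0 xa xb; apply: normr_le_coord => // i; rewrite mxE [X in _ + X]mxE.
by case: (ord2 i) => ->; rewrite ?plane_point0 ?plane_point1.
Qed.

Lemma near_bounded n (I : finType) (U : set 'rV[R]_n) (F : I -> 'rV[R]_n -> R) w :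
  (forall i, smooth U (F i)) -> U w ->
  exists2 c : R, 0 < c & \forall x \near w, forall i, `|F i x| <= c.
Proof.
move=> SF Uw; pose c := 1 + \sum_i `|F i w|.
(* The sum dominates every value at [w]; the added 1 makes the inequality strict, so that it
   persists nearby. *)
have cP i : `|F i w| < c.
  rewrite /c (bigD1 i) //= addrCA ltrDl ltr_pwDl // sumr_ge0 // => j _.
exists c; first by rewrite ltr_pwDl // sumr_ge0.
apply: (@filter_forall _ _ (fun i x => `|F i x| <= c) (nbhs w)) => i.
have := smooth_continuous (SF i) Uw.
by move=> cF; exact: (@cvgr_norm_le _ _ _ (nbhs w) _ _ _ cF _ (cP i)).
Qed.

Lemma linear_form (p q : R) : exists2 L : {linear 'rV[R]_2 -> R},
  continuous L & forall v, L v = v 0 0 * p + v 0 1 * q.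
Proof.
pose l (v : 'rV[R]_2) := v 0 0 * p + v 0 1 * q.
have lin : linear l.
  move=> k u v; rewrite /l !mxE /= [k *: (_ + _)]mulrDr; ring.
pose L : {linear 'rV[R]_2 -> R} := HB.pack l (GRing.isLinear.Build _ _ _ _ _ lin).
exists L => // v.
have : smooth setT l.
  by apply: smoothD; [exact: openT|apply: smoothM; [exact: openT|exact: smooth_coord|exact: smooth_cst]..].
by move=> /smooth_continuous; apply.
Qed.

(* Differentiation under the integral sign is avoided: the increment of the
   potential in the first variable is compared with its linear part by the mean
   value theorem, with an error quadratic in the increment. *)
Lemma poincare (U : set 'rV[R]_2) (P Q : 'rV[R]_2 -> R) w0 : open U -> U w0 ->
  smooth U P -> smooth U Q ->
  (forall w, U w -> partial 1 P w = partial 0 Q w) ->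
  exists (B : set 'rV[R]_2) F, [/\ open B, B w0, B `<=` U, smooth B F &
    forall w, B w -> partial 0 F w = P w /\ partial 1 F w = Q w].
Proof.
move=> oU Uw0 SP SQ PQ.
have SQ0 := smooth_partial 0 SQ.
(* Bounds on the first partials of these three functions make them Lipschitz near [w0];
   [partial 0 Q] is among them because the error term contains an increment of it. *)
pose Fam (jk : 'I_2 * 'I_3) := partial jk.1 (nth P [:: P; Q; partial 0 Q] jk.2).
have SFam jk : smooth U (Fam jk).
  by apply: smooth_partial; case: jk => j [[|[|[|//]]] Hk].
have [c c0 nc] := near_bounded SFam Uw0.
have [d d0 dP] := near_norm (near_and (open_nbhs_nbhs (conj oU Uw0)) nc).
have dU x : `|w0 - x| < d -> U x by move=> /dP[].
have lipF k : (k < 3)%N -> forall x y, `|w0 - x| < d -> `|w0 - y| < d ->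
    `|nth P [:: P; Q; partial 0 Q] k y - nth P [:: P; Q; partial 0 Q] k x|
      <= 2 * c * `|y - x|.
  move=> k3; apply: lipschitz_partial => [x /dU Ux|x i /dP[_ /(_ (i, Ordinal k3))]//].
  by case: k k3 => [|[|[|//]]] _; [exact: (smooth_differentiable SP)|
    exact: (smooth_differentiable SQ)|exact: (smooth_differentiable SQ0)].
have lipP := lipF 0%N isT; have lipQ := lipF 1%N isT; have lipQ0 := lipF 2%N isT.
move: lipP lipQ lipQ0 => /= lipP lipQ lipQ0 {lipF nc SFam Fam dP}.
set a0 := w0 0 0; set b0 := w0 0 1.
have inball a b : `|a0 - a| < d -> `|b0 - b| < d -> `|w0 - plane_point a b| < d.
  move=> ad bd; apply: (@le_lt_trans _ _ (Num.max `|a0 - a| `|b0 - b|)).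
    by apply: norm_plane_point; rewrite le_max ?normr_ge0 ?lexx ?orbT.
  by rewrite gt_max ad.
pose e := d / 2.
have e0 : 0 < e by rewrite divr_gt0.
have ed : e < d by rewrite ltr_pdivrMr // ltr_pMr // ltr1n.
have itv (z x : R) : z - e < x < z + e -> `|z - x| < e.
  by move=> /andP[H1 H2]; rewrite ltr_norml; lra.
have vti (z x : R) : `|z - x| < e -> z - e < x < z + e.
  by rewrite ltr_norml => /andP[H1 H2]; lra.
have itvc (z x : R) : z - e <= x <= z + e -> `|z - x| < d.
  by move=> /andP[H1 H2]; apply: le_lt_trans ed; rewrite ler_norml; lra.
have zz (z : R) : z - e < z < z + e by lra.
have lt_e (z : R) : z - e < z + e by lra.
have [F0 dF0] : exists F0 : R -> R, forall a, a0 - e < a < a0 + e ->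
    is_derive a 1 F0 (P (plane_point a b0)).
  apply: antiderivative => // a /itvc aa0.
  have Up : U (plane_point a b0) by apply: dU; apply: inball; rewrite ?subrr ?normr0.
  apply: differentiable_continuous; apply/derivable1_diffP.
  by have [] := slice0 (smooth_differentiable SP Up).
(* One primitive for each abscissa, chosen with no relation between them: only the increments from
   [b0] enter the potential. *)
have [F1 dF1] : exists F1 : R -> R -> R, forall a, `|a0 - a| < d ->
    forall b, b0 - e < b < b0 + e -> is_derive b 1 (F1 a) (Q (plane_point a b)).
  suff /choice[F1 dF1] : forall a, exists F : R -> R, `|a0 - a| < d -> forall b,
      b0 - e < b < b0 + e -> is_derive b 1 F (Q (plane_point a b)) by exists F1.
  move=> a.
  have [ad|] := pselect (`|a0 - a| < d); last by exists (fun=> 0).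
  have [|F FP] := @antiderivative (fun b => Q (plane_point a b)) _ _ (lt_e b0).
    move=> b /itvc bb0.
    have Up : U (plane_point a b) by apply: dU; exact: inball.
    apply: differentiable_continuous; apply/derivable1_diffP.
    by have [] := slice1 (smooth_differentiable SQ Up).
  by exists F => _.
(* The integral of the form along a horizontal segment at height [b0] followed by a vertical one, up
   to a constant. *)
pose G (x : 'rV[R]_2) := F0 (x 0 0) + (F1 (x 0 0) (x 0 1) - F1 (x 0 0) b0).
pose B := [set x | `|w0 - x| < e].
have oB : open B.
  apply: norm_open => p Bp; exists (e - `|w0 - p|); first by rewrite subr_gt0.
  move=> x px; rewrite /B /= -(subrKA p) (le_lt_trans (ler_normD _ _)) //.
  by rewrite -ltrBrDl.
have coordB i x : B x -> `|w0 0 i - x 0 i| < e.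
  move=> Bx; have := normr_coord (w0 - x) i; rewrite !mxE => H.
  exact: le_lt_trans H Bx.
(* One summand for each term of the decomposition [GE] below; the third term carries the extra
   factor [b - b0], of size at most [e]. *)
pose K := 2 * c + 2 * c + 2 * c * e.
have K0 : 0 < K by rewrite !addr_gt0 // !mulr_gt0.
have est x x' : B x -> B x' ->
    `|G x' - G x - ((x' - x) 0 0 * P x + (x' - x) 0 1 * Q x)| <=
    K * `|x' - x| * `|x' - x|.
  move=> Bx Bx'; set N := `|x' - x|.
  set a := x 0 0; set b := x 0 1; set a' := x' 0 0; set b' := x' 0 1.
  have aN : `|a' - a| <= N by have := normr_coord (x' - x) 0; rewrite !mxE.
  have bN : `|b' - b| <= N by have := normr_coord (x' - x) 1; rewrite !mxE.
  have ia : a0 - e < a < a0 + e by apply: vti; exact: coordB.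
  have ia' : a0 - e < a' < a0 + e by apply: vti; exact: coordB.
  have ib : b0 - e < b < b0 + e by apply: vti; exact: coordB.
  have ib' : b0 - e < b' < b0 + e by apply: vti; exact: coordB.
  have toball u v : a0 - e < u < a0 + e -> b0 - e < v < b0 + e ->
      `|w0 - plane_point u v| < d.
    by move=> /itv ud /itv vd; apply: inball; apply: lt_trans ed.
  have ad u : a0 - e < u < a0 + e -> `|a0 - u| < d.
    by move=> /itv ud; exact: lt_trans ed.
  have [z [zI za zE]] := MVT_between dF0 ia ia'.
  have [y [yI yb yE]] := MVT_between (dF1 a' (ad _ ia')) ib ib'.
  (* The defect between the increment of the vertical primitives from [a] to [a'] and its linear
     part [(a' - a) * P]. By closedness its derivative is [a' - a] times an increment of
     [partial 0 Q], hence quadratic in the displacement. *)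
  have dDel t : b0 - e < t < b0 + e -> is_derive t 1
      (fun t => F1 a' t - F1 a t - (a' - a) * P (plane_point a t))
      (Q (plane_point a' t) - Q (plane_point a t) -
        (a' - a) * partial 1 P (plane_point a t)).
    move=> tI; have h1 := dF1 a' (ad _ ia') t tI; have h2 := dF1 a (ad _ ia) t tI.
    have h3 := slice1 (smooth_differentiable SP (dU _ (toball _ _ ia tI))).
    exact: (is_deriveB (is_deriveB h1 h2) (is_deriveZ (a' - a) h3)).
  have [t [tI _ tE]] := MVT_between dDel (zz b0) ib.
  have dQt u : a0 - e < u < a0 + e -> is_derive u 1
      (fun u => Q (plane_point u t)) (partial 0 Q (plane_point u t)).
    by move=> uI; apply: slice0; exact: (smooth_differentiable SQ (dU _ (toball _ _ uI tI))).
  have [s [sI sa sE]] := MVT_between dQt ia ia'.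
  have GE : G x' - G x - ((x' - x) 0 0 * P x + (x' - x) 0 1 * Q x) =
      (P (plane_point z b0) - P (plane_point a b0)) * (a' - a) +
      (Q (plane_point a' y) - Q (plane_point a b)) * (b' - b) +
      (partial 0 Q (plane_point s t) - partial 0 Q (plane_point a t)) * (a' - a) * (b - b0).
    have E0 : (x' - x) 0 0 = a' - a by rewrite !mxE.
    have E1 : (x' - x) 0 1 = b' - b by rewrite !mxE.
    have xE : plane_point a b = x by exact: plane_pointE.
    have PQt := PQ _ (dU _ (toball _ _ ia tI)).
    rewrite E0 E1 /G -/a -/b -/a' -/b' xE.
    rewrite sE PQt xE in tE.
    move: zE yE tE.
    move: (F0 _) (F0 _) (F1 _ _) (F1 _ _) (F1 _ _) (F1 _ _) (F1 _ _) => f1 f2 f3 f4 f5 f6 f7.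
    move: (P _) (P _) (P _) (Q _) (Q _) => p1 p2 p3 q1 q2.
    move: (partial _ _ _) (partial _ _ _) => r1 r2 H1 H2 H3.
    transitivity ((f2 - f1) + (f7 - f6) +
      (f6 - f5 - (a' - a) * p2 - (f4 - f3 - (a' - a) * p1)) -
      (a' - a) * p1 - (b' - b) * q1); first by ring.
    by rewrite H1 H2 H3; ring.
  have dist (u v u' v' : R) : `|u - u'| <= N -> `|v - v'| <= N ->
      `|plane_point u v - plane_point u' v'| <= N.
    move=> uN vN; apply: norm_plane_point; rewrite ?normr_ge0 //.
      by rewrite plane_point0.
    by rewrite plane_point1.
  have N0 : 0 <= N by exact: normr_ge0.
  have lip (f : 'rV[R]_2 -> R) : (forall x y, `|w0 - x| < d -> `|w0 - y| < d -> `|f y - f x| <= 2 * c * `|y - x|) ->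
      forall u v u' v' : R, a0 - e < u < a0 + e -> b0 - e < v < b0 + e ->
      a0 - e < u' < a0 + e -> b0 - e < v' < b0 + e ->
      `|u - u'| <= N -> `|v - v'| <= N ->
      `|f (plane_point u v) - f (plane_point u' v')| <= 2 * c * N.
    move=> lf u v u' v' uI vI uI' vI' uN vN.
    rewrite (le_trans (lf _ _ (toball _ _ uI' vI') (toball _ _ uI vI))) //.
    by rewrite ler_pM2l ?mulr_gt0 //; exact: dist.
  have B1 := lip P lipP _ _ _ _ zI (zz b0) ia (zz b0) (le_trans za aN).
  have B2 := lip Q lipQ _ _ _ _ ia' yI ia ib aN (le_trans yb bN).
  have B3 := lip _ lipQ0 _ _ _ _ sI tI ia tI (le_trans sa aN).
  rewrite !subrr !normr0 in B1 B3.
  have bb0 : `|b - b0| <= e by rewrite distrC ltW //; exact: itv.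
  have -> : K * N * N = 2 * c * N * N + 2 * c * N * N + 2 * c * N * N * e.
    by rewrite /K; ring.
  rewrite GE (le_trans (ler_normD _ _)) //.
  apply: lerD; last first.
    by rewrite !normrM; apply: ler_pM => //; apply: ler_pM => //; exact: B3.
  rewrite (le_trans (ler_normD _ _)) // !normrM.
  by apply: lerD; apply: ler_pM => //; exact: B1.
have dG x : B x -> differentiable G x /\
    forall v, 'd G x v = v 0 0 * P x + v 0 1 * Q x.
  move=> Bx; have [L cL LE] := linear_form (P x) (Q x).
  suff [dGx dE] : differentiable G x /\ 'd G x = L :> ('rV[R]_2 -> R).
    by split=> // v; rewrite dE LE.
  apply: (eps_diff cL) => eps eps0.
  have [d1 d10 d1P] := open_norm oB Bx.
  exists (Num.min d1 (eps / K)); first by rewrite lt_min d10 divr_gt0.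
  move=> x'; rewrite lt_min => /andP[/d1P Bx' xx']; rewrite LE.
  rewrite (le_trans (est _ _ Bx Bx')) // ler_wpM2r // mulrC -ler_pdivlMr //.
  by rewrite distrC ltW.
have pG x : B x -> partial 0 G x = P x /\ partial 1 G x = Q x.
  move=> Bx; have [dGx dE] := dG x Bx.
  rewrite /partial !deriveE // !dE !mxE /=; split; ring.
have BU : B `<=` U by move=> x Bx; apply: dU; exact: lt_trans Bx ed.
exists B, G; split => //; first by rewrite /B /= subrr normr0.
(* Since the partials of [G] are [P] and [Q], their C^k regularity makes [G] even C^(k+1). *)
move=> k; apply: CkW; split=> [x /dG[]//|j].
case: (ord2 j) => ->.
  by apply: Ck_congr (Ck_sub BU (SP k)) => // x /pG[-> _].
by apply: Ck_congr (Ck_sub BU (SQ k)) => // x /pG[_ ->].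
Qed.

End Poincare.

(** Turns partial derivatives into variables, so that [ring] and [field] treat them as atoms and no
    conversion looks inside them. *)
Ltac gen_partial := repeat match goal with
  |- context [@partial ?R ?n ?i ?f ?p] => generalize (@partial R n i f p); intro end.

Lemma differentiable_fun_sub (R : realType) n (f g : 'rV[R]_n -> R) p :
  differentiable f p -> differentiable g p ->
  differentiable (fun x => f x - g x) p.
Proof. exact: differentiableB. Qed.

(** * Logarithmic derivatives and the web equation *)

Section LogDerivative.
Context {R : realType}.

Lemma partial_ln_norm n (g : 'rV[R]_n -> R) j p : differentiable g p -> g p != 0 ->
  partial j (fun x => ln `|g x|) p = partial j g p / g p.
Proof.
have pos (h : 'rV[R]_n -> R) : differentiable h p -> 0 < h p ->
    partial j (fun x => ln `|h x|) p = partial j h p / h p.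
  move=> dh hp.
  have dln : differentiable (@ln R) (h p).
    by apply/derivable1_diffP; have [] := is_derive1_ln hp.
  have -> : partial j (fun x => ln `|h x|) p = partial j ((@ln R) \o h) p.
    rewrite /partial; apply: near_eq_derive.
    have hpos : \forall x \near p, 0 < h x.
      exact: (@cvgr_gt _ _ (nbhs p) _ _ _ (differentiable_continuous dh) _ hp).
    by apply: filterS hpos => x /= hx; rewrite gtr0_norm.
  rewrite /partial deriveE; last exact: differentiable_comp.
  rewrite diff_comp //= diff1E // derive1E.
  rewrite (@derive_val _ _ _ _ _ _ _ (is_derive1_ln hp)).
  by rewrite /partial deriveE.
move=> dg; rewrite neq_lt => /orP[g0|g0]; last exact: pos.
have -> : (fun x => ln `|g x|) = (fun x => ln `|- g x|).
  by apply/funext => x; rewrite normrN.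
rewrite (pos (fun x => - g x)) ?oppr_gt0 //; last exact: differentiableN.
by rewrite partialN // invrN mulrNN.
Qed.

(** Closedness of d ln|g|, stated through quotients so that no logarithm has to be
    differentiated. *)
Lemma dlogC n (W : set 'rV[R]_n) (g : 'rV[R]_n -> R) i j w : open W ->
  smooth W g -> (forall x, W x -> g x != 0) -> W w ->
  partial i (fun x => partial j g x / g x) w =
  partial j (fun x => partial i g x / g x) w.
Proof.
move=> oW Sg g0 Ww.
have d k := smooth_differentiable (smooth_partial k Sg) Ww.
have dg := smooth_differentiable Sg Ww.
have E k l := partial_div l (d k) dg (g0 w Ww).
rewrite (E j i) (E i j) (partialC i j oW (Sg 2%N) Ww).
by gen_partial; move: (g w) => c; congr (_ / _); congr (_ - _); rewrite mulrC.
Qed.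

Lemma web_equation_dlog (W : set 'rV[R]_2) (f : 'rV[R]_2 -> R) : open W ->
  smooth W f -> (forall w, W w -> partial 0 f w != 0) ->
  (forall w, W w -> partial 1 f w != 0) ->
  web_equation W f <-> forall w, W w ->
    partial 1 (fun u => partial 0 (fun x => partial 0 f x / partial 1 f x) u /
      (partial 0 f u / partial 1 f u)) w = 0.
Proof.
move=> oW Sf f0 f1; set q := fun x => partial 0 f x / partial 1 f x.
have Sq : smooth W q by apply: smooth_div => //; exact: smooth_partial.
have E w : W w -> partial 0 (fun u => ln `|q u|) w = partial 0 q w / q w.
  move=> Ww; apply: partial_ln_norm; first exact: smooth_differentiable Sq Ww.
  exact: (mulf_neq0 (f0 w Ww) (invr_neq0 (f1 w Ww))).
have EE w (Ww : W w) := partial_congr 1 oW E Ww.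
split=> H w Ww; first exact: (etrans (esym (EE w Ww)) (H w Ww)).
exact: (etrans (EE w Ww) (H w Ww)).
Qed.

End LogDerivative.

(** * The 1-form on the hodograph space and its closedness *)

Section Coefficients.
Context {R : realType} (U : set 'rV[R]_3) (v : 'I_3 -> 'rV[R]_3 -> R).
Context (openU : open U) (v_smooth : forall i, smooth U (v i))
  (v_distinct : forall i j p, U p -> i != j -> v i p != v j p)
  (v_lindeg : linearly_degenerate U v) (v_semiham : semi_hamiltonian U v).

(** For distinct indices this is the derivative along [j] of ln H_i, where H_i is the i-th Lame
    coefficient of the system; the semi-Hamiltonian condition is the compatibility of these
    equations for H_i, and unfolds to an identity between derivatives of [rotation]. *)
Definition rotation i j q := partial j (v i) q / (v j q - v i q).

(* The coefficient of dR^3 in the 1-form produced by the elimination of [x]. *)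
Definition shear q :=
  - ((partial 2 (v 1) q - partial 2 (v 0) q) / (v 1 q - v 0 q) +
     rotation 1 2 q + rotation 0 2 q).

Lemma v_sub_neq0 i j p : U p -> i != j -> v i p - v j p != 0.
Proof. by move=> Up ij; rewrite subr_eq0; exact: v_distinct. Qed.

Lemma smooth_rotation i j : i != j -> smooth U (rotation i j).
Proof.
move=> ij; apply: smooth_div => // [x Ux||].
- by apply: v_sub_neq0 => //; rewrite eq_sym.
- exact: smooth_partial.
- exact: smoothB.
Qed.

Lemma smooth_shear : smooth U shear.
Proof.
apply: smoothN => //; apply: smoothD => //; last exact: smooth_rotation.
apply: smoothD => //; last exact: smooth_rotation.
apply: smooth_div => // [x Ux||].
- exact: v_sub_neq0.
- by apply: smoothB => //; exact: smooth_partial.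
- exact: smoothB.
Qed.

Lemma partial_rotation i j k p : i != j -> U p ->
  partial k (rotation i j) p =
  (partial k (partial j (v i)) p * (v j p - v i p) -
   partial j (v i) p * (partial k (v j) p - partial k (v i) p)) /
  (v j p - v i p) ^+ 2.
Proof.
move=> ij Up; have dv l := smooth_differentiable (v_smooth l) Up.
have dpv l m := smooth_differentiable (smooth_partial l (v_smooth m)) Up.
have v0 : v j p - v i p != 0 by apply: v_sub_neq0 => //; rewrite eq_sym.
rewrite /rotation (partial_div k (dpv j i) (differentiable_fun_sub (dv j) (dv i)) v0).
by rewrite (partialB k (dv j) (dv i)).
Qed.

Lemma partial_lindeg k i p : U p -> partial k (partial i (v i)) p = 0.
Proof.
move=> Up; rewrite (partial_congr k openU (g := fun=> 0)) ?partial_cst //.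
by move=> x Ux; exact: v_lindeg.
Qed.

Lemma partial_lindegC k i p : U p -> partial i (partial k (v i)) p = 0.
Proof.
by move=> Up; rewrite (partialC _ _ openU (v_smooth i 2%N)) // partial_lindeg.
Qed.

(** The derivatives of [rotation] stay folded, so that the semi-Hamiltonian condition can rewrite
    one of them before everything is expanded. *)
Lemma partial_shear k p : U p -> partial k shear p =
  - ((partial k (partial 2 (v 1)) p - partial k (partial 2 (v 0)) p) / (v 1 p - v 0 p)
     - (partial 2 (v 1) p - partial 2 (v 0) p) * (partial k (v 1) p - partial k (v 0) p)
       / (v 1 p - v 0 p) ^+ 2
     + partial k (rotation 1 2) p + partial k (rotation 0 2) p).
Proof.
move=> Up; have dv l := smooth_differentiable (v_smooth l) Up.
have dpv l m := smooth_differentiable (smooth_partial l (v_smooth m)) Up.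
have n12 : (1 : 'I_3) != 2 by [].
have n02 : (0 : 'I_3) != 2 by [].
have dr12 := smooth_differentiable (smooth_rotation n12) Up.
have dr02 := smooth_differentiable (smooth_rotation n02) Up.
have v10 : v 1 p - v 0 p != 0 by exact: v_sub_neq0.
pose A q := (partial 2 (v 1) q - partial 2 (v 0) q) / (v 1 q - v 0 q).
have SA : smooth U A.
  apply: smooth_div => // [x Ux||]; [exact: v_sub_neq0| |exact: smoothB].
  by apply: smoothB => //; exact: smooth_partial.
have dA := smooth_differentiable SA Up.
rewrite (partialN k (differentiableD (differentiableD dA dr12) dr02)).
rewrite (partialD k (differentiableD dA dr12) dr02) (partialD k dA dr12).
rewrite /A (partial_div k (differentiable_fun_sub (dpv 2 1) (dpv 2 0)) (differentiable_fun_sub (dv 1) (dv 0)) v10).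
rewrite (partialB k (dpv 2 1) (dpv 2 0)) (partialB k (dv 1) (dv 0)).
move: v10; gen_partial; move: (v 1 p) (v 0 p) => ? ? v10; congr (- (_ + _ + _)). field.
by [].
Qed.

(* With the semi-Hamiltonian condition for i = 3, the next two identities say
   that the 1-form shear dR^3 - rotation_31 dR^1 - rotation_32 dR^2 is closed
   (the indices of [rotation] and [partial] below are shifted by one). *)
Lemma partial0_shear p : U p -> partial 0 shear p = - partial 2 (rotation 2 0) p.
Proof.
move=> Up; rewrite (partial_shear _ Up).
have n10 : (1 : 'I_3) != 0 by [].
have n02 : (0 : 'I_3) != 2 by [].
have n20 : (2 : 'I_3) != 0 by [].
have v10 := v_sub_neq0 Up n10.
have v20 := v_sub_neq0 Up n20.
have v02 := v_sub_neq0 Up n02.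
have v01 : v 0 p - v 1 p != 0 by exact: v_sub_neq0.
(* As [partial 0 (v 0)] vanishes, the mixed derivative of ln|v 1 - v 0| along 0 and 2 is minus
   [partial 2 (rotation 1 0)], and this rewriting makes the two cancel. What is left is the equality
   of [partial 0 (rotation 0 2)] and [partial 2 (rotation 2 0)]: by linear degeneracy both are minus
   the product of [partial 2 (v 0)] and [partial 0 (v 2)] over [(v 2 - v 0) ^+ 2]. *)
have -> : partial 0 (rotation 1 2) p = partial 2 (rotation 1 0) p.
  exact: v_semiham.
rewrite (partial_rotation 2 n10 Up) (partial_rotation 0 n02 Up) (partial_rotation 2 n20 Up).
have eC := partialC 2 0 openU (v_smooth 1 2%N) Up.
move: v10 v20 v01 v02 eC (partial_lindegC 2 0 Up) (partial_lindegC 0 2 Up)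
  (v_lindeg 0 Up) (v_lindeg 2 Up).
gen_partial; move: (v 0 p) (v 1 p) (v 2 p) => x y z.
move=> v10 v20 v01 v02 -> -> -> -> ->; field.
by rewrite v10 v20 v01 v02.
Qed.

Lemma partial1_shear p : U p -> partial 1 shear p = - partial 2 (rotation 2 1) p.
Proof.
move=> Up; rewrite (partial_shear _ Up).
have n01 : (0 : 'I_3) != 1 by [].
have n12 : (1 : 'I_3) != 2 by [].
have n21 : (2 : 'I_3) != 1 by [].
have v01 := v_sub_neq0 Up n01.
have v21 := v_sub_neq0 Up n21.
have v12 := v_sub_neq0 Up n12.
have v10 : v 1 p - v 0 p != 0 by exact: v_sub_neq0.
(* The same cancellation with the indices 0 and 1 exchanged. *)
have -> : partial 1 (rotation 0 2) p = partial 2 (rotation 0 1) p.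
  exact: v_semiham.
rewrite (partial_rotation 2 n01 Up) (partial_rotation 1 n12 Up) (partial_rotation 2 n21 Up).
have eC := partialC 2 1 openU (v_smooth 0 2%N) Up.
move: v10 v21 v01 v12 eC (partial_lindegC 2 1 Up) (partial_lindegC 1 2 Up)
  (v_lindeg 1 Up) (v_lindeg 2 Up).
gen_partial; move: (v 0 p) (v 1 p) (v 2 p) => x y z.
move=> v10 v21 v01 v12 -> -> -> -> ->; field.
by rewrite ?v10 ?v21 ?v01 ?v12.
Qed.

End Coefficients.

(** * Graphs over the (R^1, R^2)-plane *)

Section Graph.
Context {R : realType}.

Lemma ord3 (i : 'I_3) : [\/ i = 0, i = 1 | i = 2].
Proof.
by case: i => [[|[|[|//]]] Hi];
  [constructor 1|constructor 2|constructor 3]; apply: val_inj.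
Qed.

Lemma component_graph0 (f : 'rV[R]_2 -> R) :
  component (graph_map f) 0 = (fun w => w 0 0).
Proof.
apply/funext => w; rewrite /component /graph_map.
have -> : (0 : 'I_3) = lshift 1 (0 : 'I_2) by apply: val_inj.
exact: row_mxEl.
Qed.

Lemma component_graph1 (f : 'rV[R]_2 -> R) :
  component (graph_map f) 1 = (fun w => w 0 1).
Proof.
apply/funext => w; rewrite /component /graph_map.
have -> : (1 : 'I_3) = lshift 1 (1 : 'I_2) by apply: val_inj.
exact: row_mxEl.
Qed.

Lemma component_graph2 (f : 'rV[R]_2 -> R) : component (graph_map f) 2 = f.
Proof.
apply/funext => w; rewrite /component /graph_map.
have -> : (2 : 'I_3) = rshift 2 (0 : 'I_1) by apply: val_inj.
by apply: (etrans (row_mxEr _ _ _ _)); rewrite mxE.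
Qed.

Lemma smooth_graph_map (W : set 'rV[R]_2) f : smooth W f -> smooth_map W (graph_map f).
Proof.
move=> Sf i; case: (ord3 i) => ->.
- by rewrite component_graph0; exact: smooth_coord.
- by rewrite component_graph1; exact: smooth_coord.
- by rewrite component_graph2.
Qed.

Lemma big_ord3 (F : 'I_3 -> R) : \sum_i F i = F 0 + F 1 + F 2.
Proof.
rewrite !big_ord_recl big_ord0 addr0 addrA; congr (F _ + F _ + F _); exact: val_inj.
Qed.

Lemma partial_graph (f : 'rV[R]_2 -> R) (g : 'rV[R]_3 -> R) w j :
  differentiable g (graph_map f w) -> differentiable f w ->
  partial j (fun x => g (graph_map f x)) w =
  (0 == j)%:R * partial 0 g (graph_map f w) +
  (1 == j)%:R * partial 1 g (graph_map f w) +
  partial 2 g (graph_map f w) * partial j f w.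
Proof.
move=> dg df.
have dG i : differentiable (component (graph_map f) i) w.
  case: (ord3 i) => ->.
  - by rewrite component_graph0; exact: differentiable_coord.
  - by rewrite component_graph1; exact: differentiable_coord.
  - by rewrite component_graph2.
rewrite (partial_comp j dg dG) big_ord3.
rewrite component_graph0 component_graph1 component_graph2 !partial_coord.
by gen_partial => *; congr (_ + _ + _); rewrite mulrC.
Qed.

Lemma partial0_graph (f : 'rV[R]_2 -> R) (g : 'rV[R]_3 -> R) w :
  differentiable g (graph_map f w) -> differentiable f w ->
  partial 0 (fun x => g (graph_map f x)) w =
  partial 0 g (graph_map f w) + partial 2 g (graph_map f w) * partial 0 f w.
Proof. by move=> dg df; rewrite (partial_graph _ dg df) mul1r mul0r addr0. Qed.

Lemma partial1_graph (f : 'rV[R]_2 -> R) (g : 'rV[R]_3 -> R) w :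
  differentiable g (graph_map f w) -> differentiable f w ->
  partial 1 (fun x => g (graph_map f x)) w =
  partial 1 g (graph_map f w) + partial 2 g (graph_map f w) * partial 1 f w.
Proof. by move=> dg df; rewrite (partial_graph _ dg df) mul1r mul0r add0r. Qed.

End Graph.

(** * Pointwise algebra of the hodograph equations *)

Section HodographAlgebra.
Context {K : fieldType} (v0 v1 v2 fa fb : K).
Context (fa0 : fa != 0) (fb0 : fb != 0) (v21 : v2 - v1 != 0) (v20 : v2 - v0 != 0)
  (v01 : v0 - v1 != 0).

Let v12 : v1 - v2 != 0. Proof. by rewrite -opprB oppr_eq0. Qed.
Let v02 : v0 - v2 != 0. Proof. by rewrite -opprB oppr_eq0. Qed.
Let v10 : v1 - v0 != 0. Proof. by rewrite -opprB oppr_eq0. Qed.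

(** Here and below [fa], [fb], [ta], [tb] stand for the partials of f and t along 0 and 1, [T] for
    the mixed derivative of t, and [dij] for [partial i (v j)]. The hypothesis equates the two mixed
    derivatives of x; its zeros are [partial 0 (v 0)] and [partial 1 (v 1)]. *)
Lemma hodograph_key a b c d T :
  - ((0 + a) * b + v0 * T) = - ((0 + c) * d + v1 * T) ->
  (v0 - v1) * T = c * d - a * b.
Proof.
rewrite !add0r => /oppr_inj E.
transitivity (a * b + v0 * T - a * b - v1 * T); first by ring.
by rewrite E; ring.
Qed.

Lemma hodograph_ratio ta tb :
  (v2 - v1) * ta * fb = (v2 - v0) * tb * fa ->
  ta * (v2 - v1) = fa / fb * (tb * (v2 - v0)).
Proof.
move=> E; apply: (mulIf fb0); transitivity ((v2 - v1) * ta * fb); first by ring.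
by rewrite E; field.
Qed.

(** The logarithmic derivative of m along 1. After [T] is replaced by its value and [tb] by its
    multiple of [ta], the unknown [ta] cancels and the coefficient [form_b] remains. *)
Lemma hodograph_dlog_a ta tb T d21 d20 d12 : ta != 0 ->
  (v2 - v1) * ta * fb = (v2 - v0) * tb * fa ->
  (v0 - v1) * T = d21 * fb * ta - d20 * fa * tb ->
  (T * (v2 - v1) + ta * (d12 - d21 * fb)) / (ta * (v2 - v1)) =
  fb * - ((d21 - d20) / (v1 - v0) + d21 / (v2 - v1) + d20 / (v2 - v0))
  - d12 / (v1 - v2).
Proof.
move=> ta0 /esym E ET.
have -> : T = (d21 * fb * ta - d20 * fa * tb) / (v0 - v1) by rewrite -ET mulrC mulKf.
have -> : tb = (v2 - v1) * ta * fb / (v2 - v0) / fa.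
  by rewrite -E; field; rewrite ?fa0 ?v20.
by field; rewrite ?fa0 ?ta0 ?v20 ?v21 ?v01 ?v10 ?v12.
Qed.

Lemma hodograph_dlog_b ta tb T d21 d20 d02 : tb != 0 ->
  (v2 - v1) * ta * fb = (v2 - v0) * tb * fa ->
  (v0 - v1) * T = d21 * fb * ta - d20 * fa * tb ->
  (T * (v2 - v0) + tb * (d02 - d20 * fa)) / (tb * (v2 - v0)) =
  fa * - ((d21 - d20) / (v1 - v0) + d21 / (v2 - v1) + d20 / (v2 - v0))
  - d02 / (v0 - v2).
Proof.
move=> tb0 E ET.
have -> : T = (d21 * fb * ta - d20 * fa * tb) / (v0 - v1) by rewrite -ET mulrC mulKf.
have -> : ta = (v2 - v0) * tb * fa / (v2 - v1) / fb.
  by rewrite -E; field; rewrite ?fb0 ?v21.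
by field; rewrite ?fb0 ?tb0 ?v20 ?v21 ?v01 ?v10 ?v02.
Qed.

Lemma slope_dlog (q n dq dn : K) : q != 0 -> n != 0 ->
  dq / q = (dq * n + q * dn) / (q * n) - dn / n.
Proof. by move=> q0 n0; field; rewrite q0 n0. Qed.

Let S d21 d20 := - ((d21 - d20) / (v1 - v0) + d21 / (v2 - v1) + d20 / (v2 - v0)).

(** Compatibility of the second quadrature: the derivatives of t recovered from m and from n = m / q
    have equal cross derivatives. *)
Lemma hodograph_mixed m d21 d20 d12 d02 :
  (m * (fb * S d21 d20 - d12 / (v1 - v2)) * (v2 - v1) - m * (d12 - d21 * fb)) / (v2 - v1) ^+ 2 =
  (m / (fa / fb) * (fa * S d21 d20 - d02 / (v0 - v2)) * (v2 - v0)
     - m / (fa / fb) * (d02 - d20 * fa)) / (v2 - v0) ^+ 2.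
Proof. by rewrite /S; field; rewrite ?fb0 ?fa0 ?v20 ?v21 ?v01 ?v10 ?v02 ?v12. Qed.

(** Compatibility of the third quadrature, for x, with [T] the mixed derivative of t already
    found. *)
Lemma hodograph_mixed_x m d21 d20 d12 :
  let T := (m * (fb * S d21 d20 - d12 / (v1 - v2)) * (v2 - v1)
    - m * (d12 - d21 * fb)) / (v2 - v1) ^+ 2 in
  - (d21 * fb * (m / (v2 - v1)) + v1 * T) =
  - (d20 * fa * (m / (fa / fb) / (v2 - v0)) + v0 * T).
Proof. by rewrite /= /S; field; rewrite ?fb0 ?fa0 ?v20 ?v21 ?v01 ?v10 ?v12. Qed.

End HodographAlgebra.

(** * The hodograph system on a graph and the web equation *)

Section HydrodynamicGraph.
Context {R : realType} (U : set 'rV[R]_3) (v : 'I_3 -> 'rV[R]_3 -> R).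
Context (openU : open U) (v_smooth : forall i, smooth U (v i))
  (v_distinct : forall i j p, U p -> i != j -> v i p != v j p)
  (v_lindeg : linearly_degenerate U v) (v_semiham : semi_hamiltonian U v).
Context (W : set 'rV[R]_2) (f : 'rV[R]_2 -> R) (openW : open W)
  (f_smooth : smooth W f) (f0 : forall w, W w -> partial 0 f w != 0)
  (f1 : forall w, W w -> partial 1 f w != 0)
  (WU : forall w, W w -> U (graph_map f w)).

Let q := fun w => partial 0 f w / partial 1 f w.

(* The pullback of the closed 1-form shear dR^3 - rotation_31 dR^1 - rotation_32 dR^2
   to the graph is [form_a dR^1 + form_b dR^2]. *)
Definition form_a w := partial 0 f w * shear v (graph_map f w) - rotation v 2 0 (graph_map f w).
Definition form_b w := partial 1 f w * shear v (graph_map f w) - rotation v 2 1 (graph_map f w).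

Lemma smooth_on_graph g : smooth U g -> smooth W (fun w => g (graph_map f w)).
Proof. by move=> Sg; apply: (smooth_comp openW WU (smooth_graph_map f_smooth) Sg). Qed.

Lemma smooth_form_a : smooth W form_a.
Proof.
apply: smoothB => //; last by apply: smooth_on_graph; exact: smooth_rotation.
apply: smoothM => //; first exact: smooth_partial.
by apply: smooth_on_graph; exact: smooth_shear.
Qed.

Lemma smooth_form_b : smooth W form_b.
Proof.
apply: smoothB => //; last by apply: smooth_on_graph; exact: smooth_rotation.
apply: smoothM => //; first exact: smooth_partial.
by apply: smooth_on_graph; exact: smooth_shear.
Qed.

Lemma smooth_slope : smooth W q.
Proof. by apply: smooth_div => //; exact: smooth_partial. Qed.

Lemma slope_neq0 w : W w -> q w != 0.
Proof. by move=> Ww; exact: (mulf_neq0 (f0 Ww) (invr_neq0 (f1 Ww))). Qed.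

(** A pullback of a closed form is closed. Upstairs, two of the three closedness identities are
    [partial0_shear] and [partial1_shear]; the third is the semi-Hamiltonian condition for the index
    2. *)
Lemma form_closed w : W w -> partial 0 form_b w = partial 1 form_a w.
Proof.
move=> Ww; have Up := WU Ww.
have n20 : (2 : 'I_3) != 0 by [].
have n21 : (2 : 'I_3) != 1 by [].
have Ss := smooth_shear openU v_smooth v_distinct.
have Sr0 := smooth_rotation openU v_smooth v_distinct n20.
have Sr1 := smooth_rotation openU v_smooth v_distinct n21.
have df := smooth_differentiable f_smooth Ww.
have dpf j := smooth_differentiable (smooth_partial j f_smooth) Ww.
have dsG := smooth_differentiable (smooth_on_graph Ss) Ww.
have dr0G := smooth_differentiable (smooth_on_graph Sr0) Ww.
have dr1G := smooth_differentiable (smooth_on_graph Sr1) Ww.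
have ds := smooth_differentiable Ss Up.
have dr0 := smooth_differentiable Sr0 Up.
have dr1 := smooth_differentiable Sr1 Up.
rewrite /form_a /form_b.
rewrite (partialB 0 (differentiableM (dpf 1) dsG) dr1G) (partialM 0 (dpf 1) dsG).
rewrite (partialB 1 (differentiableM (dpf 0) dsG) dr0G) (partialM 1 (dpf 0) dsG).
rewrite (partial0_graph ds df) (partial0_graph dr1 df).
rewrite (partial1_graph ds df) (partial1_graph dr0 df).
have := partial0_shear openU v_smooth v_distinct v_lindeg v_semiham Up.
have := partial1_shear openU v_smooth v_distinct v_lindeg v_semiham Up.
have n01 : (0 : 'I_3) != 1 by [].
have : partial 1 (rotation v 2 0) (graph_map f w) = partial 0 (rotation v 2 1) (graph_map f w).
  exact: v_semiham n20 n21 n01 _ Up.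
have := partialC 0 1 openW (f_smooth 2%N) Ww.
gen_partial; move: (shear v _) => sh.
move=> H1 H2 H3 H4; rewrite H1 H2 H3 H4; ring.
Qed.

(* The differential of the parameter change (x, t) of a solution, written in the
   coordinates (R^1, R^2) of the surface. *)
Definition hodograph_system B (x t : 'rV[R]_2 -> R) := forall w, B w ->
  [/\ partial 1 x w = - v 0 (graph_map f w) * partial 1 t w,
      partial 0 x w = - v 1 (graph_map f w) * partial 0 t w &
      (v 2 (graph_map f w) - v 1 (graph_map f w)) * partial 0 t w * partial 1 f w =
      (v 2 (graph_map f w) - v 0 (graph_map f w)) * partial 1 t w * partial 0 f w].

Let V i w := v i (graph_map f w).

Lemma smooth_V i : smooth W (V i).
Proof. exact: smooth_on_graph. Qed.

Lemma V_sub_neq0 i j w : W w -> i != j -> V i w - V j w != 0.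
Proof. by move=> Ww ij; apply: (v_sub_neq0 v_distinct) => //; exact: WU. Qed.

Lemma partial0_V i w : W w -> partial 0 (V i) w =
  partial 0 (v i) (graph_map f w) + partial 2 (v i) (graph_map f w) * partial 0 f w.
Proof.
move=> Ww; apply: partial0_graph; last exact: smooth_differentiable f_smooth Ww.
exact: smooth_differentiable (v_smooth i) (WU Ww).
Qed.

Lemma partial1_V i w : W w -> partial 1 (V i) w =
  partial 1 (v i) (graph_map f w) + partial 2 (v i) (graph_map f w) * partial 1 f w.
Proof.
move=> Ww; apply: partial1_graph; last exact: smooth_differentiable f_smooth Ww.
exact: smooth_differentiable (v_smooth i) (WU Ww).
Qed.

(** In this direction linear degeneracy leaves a single derivative of each of the two velocities;
    for the difference in m the same happens along 1. *)
Lemma partial0_V20 w : W w -> partial 0 (fun w => V 2 w - V 0 w) w =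
  partial 0 (v 2) (graph_map f w) - partial 2 (v 0) (graph_map f w) * partial 0 f w.
Proof.
move=> Ww; have dV i := smooth_differentiable (smooth_V i) Ww.
rewrite (partialB 0 (dV 2) (dV 0)) (partial0_V 2 Ww) (partial0_V 0 Ww).
move: (v_lindeg 2 (WU Ww)) (v_lindeg 0 (WU Ww)).
by gen_partial; move=> -> ->; rewrite mul0r addr0 add0r.
Qed.

Lemma partial1_V21 w : W w -> partial 1 (fun w => V 2 w - V 1 w) w =
  partial 1 (v 2) (graph_map f w) - partial 2 (v 1) (graph_map f w) * partial 1 f w.
Proof.
move=> Ww; have dV i := smooth_differentiable (smooth_V i) Ww.
rewrite (partialB 1 (dV 2) (dV 1)) (partial1_V 2 Ww) (partial1_V 1 Ww).
move: (v_lindeg 2 (WU Ww)) (v_lindeg 1 (WU Ww)).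
by gen_partial; move=> -> ->; rewrite mul0r addr0 add0r.
Qed.

Lemma hodograph_web (x t : 'rV[R]_2 -> R) :
  smooth W x -> smooth W t -> hodograph_system W x t ->
  (forall w, W w -> partial 0 t w != 0) -> (forall w, W w -> partial 1 t w != 0) ->
  forall w, W w -> partial 1 (fun u => partial 0 q u / q u) w = 0.
Proof.
move=> Sx St H t0 t1.
have n01 : (0 : 'I_3) != 1 by [].
have n10 : (1 : 'I_3) != 0 by [].
have n12 : (1 : 'I_3) != 2 by [].
have n21 : (2 : 'I_3) != 1 by [].
have n20 : (2 : 'I_3) != 0 by [].
have n02 : (0 : 'I_3) != 2 by [].
pose m w := partial 0 t w * (V 2 w - V 1 w).
pose n w := partial 1 t w * (V 2 w - V 0 w).
have Sm : smooth W m.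
  apply: smoothM => //; first exact: smooth_partial.
  by apply: smoothB => //; exact: smooth_V.
have Sn : smooth W n.
  apply: smoothM => //; first exact: smooth_partial.
  by apply: smoothB => //; exact: smooth_V.
have m0 w : W w -> m w != 0.
  by move=> Ww; exact: (mulf_neq0 (t0 w Ww) (V_sub_neq0 Ww n21)).
have n0 w : W w -> n w != 0.
  by move=> Ww; exact: (mulf_neq0 (t1 w Ww) (V_sub_neq0 Ww n20)).
have mq w : W w -> m w = q w * n w.
  move=> Ww; have [_ _] := H w Ww; rewrite /m /n /q -/(V 2 w) -/(V 1 w) -/(V 0 w).
  exact: (@hodograph_ratio R _ _ _ _ _ (f1 Ww)).
have key w : W w ->
    (V 0 w - V 1 w) * partial 1 (partial 0 t) w =
    partial 2 (v 1) (graph_map f w) * partial 1 f w * partial 0 t w -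
    partial 2 (v 0) (graph_map f w) * partial 0 f w * partial 1 t w.
  move=> Ww; have dV i := smooth_differentiable (smooth_V i) Ww.
  have dt i := smooth_differentiable (smooth_partial i St) Ww.
  have e1 : partial 0 (partial 1 x) w = - (partial 0 (V 0) w * partial 1 t w +
      V 0 w * partial 0 (partial 1 t) w).
    apply: (etrans (partial_congr 0 openW (g := fun w => - (V 0 w * partial 1 t w)) _ Ww)).
      by move=> y Wy; have [E _ _] := H y Wy; rewrite E mulNr.
    apply: (etrans (partialN 0 (differentiableM (dV 0) (dt 1)))).
    exact: (congr1 -%R (partialM 0 (dV 0) (dt 1))).
  have e2 : partial 1 (partial 0 x) w = - (partial 1 (V 1) w * partial 0 t w +
      V 1 w * partial 1 (partial 0 t) w).
    apply: (etrans (partial_congr 1 openW (g := fun w => - (V 1 w * partial 0 t w)) _ Ww)).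
      by move=> y Wy; have [_ E _] := H y Wy; rewrite E mulNr.
    apply: (etrans (partialN 1 (differentiableM (dV 1) (dt 0)))).
    exact: (congr1 -%R (partialM 1 (dV 1) (dt 0))).
  have eC := partialC 0 1 openW (Sx 2%N) Ww; rewrite e1 e2 in eC.
  have eT := partialC 0 1 openW (St 2%N) Ww.
  move: eC eT (v_lindeg 1 (WU Ww)) (v_lindeg 0 (WU Ww)).
  rewrite (partial0_V 0 Ww) (partial1_V 1 Ww).
  gen_partial; move: (V 0 w) (V 1 w) => v0 v1 E eT e3 e4; move: E; rewrite eT e3 e4.
  exact: hodograph_key.
have dm w : W w -> partial 1 m w / m w = form_b w.
  move=> Ww; have dV i := smooth_differentiable (smooth_V i) Ww.
  have dt i := smooth_differentiable (smooth_partial i St) Ww.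
  rewrite /m (partialM 1 (dt 0) (differentiable_fun_sub (dV 2) (dV 1))) (partial1_V21 Ww).
  have [_ _] := H w Ww; rewrite -/(V 2 w) -/(V 1 w) -/(V 0 w).
  rewrite /form_b /shear /rotation -/(V 2 w) -/(V 1 w) -/(V 0 w) => E.
  exact: (@hodograph_dlog_a R _ _ _ _ _ (f0 Ww) (V_sub_neq0 Ww n21) (V_sub_neq0 Ww n20)
    (V_sub_neq0 Ww n01) _ _ _ _ _ _ (t0 w Ww) E (key w Ww)).
have dn w : W w -> partial 0 n w / n w = form_a w.
  move=> Ww; have dV i := smooth_differentiable (smooth_V i) Ww.
  have dt i := smooth_differentiable (smooth_partial i St) Ww.
  rewrite /n (partialM 0 (dt 1) (differentiable_fun_sub (dV 2) (dV 0))) (partial0_V20 Ww).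
  rewrite (partialC 0 1 openW (St 2%N) Ww).
  have [_ _] := H w Ww; rewrite -/(V 2 w) -/(V 1 w) -/(V 0 w).
  rewrite /form_a /shear /rotation -/(V 2 w) -/(V 1 w) -/(V 0 w) => E.
  exact: (@hodograph_dlog_b R _ _ _ _ _ (f1 Ww) (V_sub_neq0 Ww n21) (V_sub_neq0 Ww n20)
    (V_sub_neq0 Ww n01) _ _ _ _ _ _ (t1 w Ww) E (key w Ww)).
have dq w : W w -> partial 0 q w / q w = partial 0 m w / m w - form_a w.
  move=> Ww; rewrite -(dn w Ww).
  rewrite (partial_congr 0 openW mq Ww) (mq w Ww).
  rewrite (partialM 0 (smooth_differentiable smooth_slope Ww) (smooth_differentiable Sn Ww)).
  exact: (@slope_dlog R _ _ _ _ (slope_neq0 Ww) (n0 w Ww)).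
move=> w Ww.
have Sdm : smooth W (fun w => partial 0 m w / m w).
  by apply: smooth_div => //; exact: smooth_partial.
rewrite (partial_congr 1 openW dq Ww).
rewrite (partialB 1 (smooth_differentiable Sdm Ww) (smooth_differentiable smooth_form_a Ww)).
(* [dm] controls m along 1 only, so the order of differentiation of ln|m| is exchanged first. *)
rewrite (dlogC 1 0 openW Sm m0 Ww) (partial_congr 0 openW dm Ww) (form_closed Ww).
exact: subrr.
Qed.

Lemma web_hodograph w0 : W w0 ->
  (forall w, W w -> partial 1 (fun u => partial 0 q u / q u) w = 0) ->
  exists (B : set 'rV[R]_2) x t, [/\ open B, B w0, B `<=` W,
    smooth B x /\ smooth B t & hodograph_system B x t /\
    forall w, B w -> partial 0 t w != 0 /\ partial 1 t w != 0].
Proof.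
move=> Ww0 web.
have n01 : (0 : 'I_3) != 1 by [].
have n21 : (2 : 'I_3) != 1 by [].
have n20 : (2 : 'I_3) != 0 by [].
have Sq := smooth_slope; have Sa := smooth_form_a; have Sb := smooth_form_b.
pose dq w := partial 0 q w / q w.
have Sdq : smooth W dq.
  apply: smooth_div => //; [exact: slope_neq0|exact: smooth_partial].
(* First quadrature, with rho = ln m. Since m = q n and n must have logarithmic derivative [form_a]
   along 0, the derivative of rho along 0 is [form_a + dq]; the web equation says that adding [dq]
   keeps the form closed. *)
have [w Ww|B1 [rho [oB1 B1w0 B1W Srho rhoE]]] :=
  poincare openW Ww0 (smoothD openW Sa Sdq) Sb.
  rewrite (partialD 1 (smooth_differentiable Sa Ww) (smooth_differentiable Sdq Ww)).
  by rewrite (web w Ww) (form_closed Ww) addr0.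
(* The exponential keeps m nonzero, hence also both derivatives of t, on which the invertibility of
   (x, t) rests. *)
pose m w := expR (rho w); pose n w := m w / q w.
have m0 w : m w != 0 by rewrite gt_eqF // expR_gt0.
have Sm : smooth B1 m by exact: smooth_expR.
have Sq1 : smooth B1 q := smooth_sub B1W Sq.
have q0 w : B1 w -> q w != 0 by move=> /B1W; exact: slope_neq0.
have Sn : smooth B1 n by exact: smooth_div.
have dm1 w : B1 w -> partial 1 m w = m w * form_b w.
  move=> Bw; rewrite (partial_expR 1 (smooth_differentiable Srho Bw)).
  by have [_ ->] := rhoE w Bw.
have dn0 w : B1 w -> partial 0 n w = n w * form_a w.
  move=> Bw; rewrite (partial_div 0 (smooth_differentiable Sm Bw)
    (smooth_differentiable Sq1 Bw) (q0 w Bw)).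
  rewrite (partial_expR 0 (smooth_differentiable Srho Bw)).
  have [-> _] := rhoE w Bw; rewrite /dq /n -/(m w).
  move: (q0 w Bw); gen_partial; move: (m w) (q w) (form_a w) => ? ? ? qn0.
  by field.
have SV i : smooth B1 (V i) := smooth_sub B1W (smooth_V i).
have V21 w : B1 w -> V 2 w - V 1 w != 0 by move=> /B1W Ww; exact: V_sub_neq0.
have V20 w : B1 w -> V 2 w - V 0 w != 0 by move=> /B1W Ww; exact: V_sub_neq0.
have S21 : smooth B1 (fun w => V 2 w - V 1 w) by exact: smoothB.
have S20 : smooth B1 (fun w => V 2 w - V 0 w) by exact: smoothB.
pose ta w := m w / (V 2 w - V 1 w); pose tb w := n w / (V 2 w - V 0 w).
have Sta : smooth B1 ta by exact: smooth_div.
have Stb : smooth B1 tb by exact: smooth_div.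
have dta w : B1 w -> partial 1 ta w =
    (m w * form_b w * (V 2 w - V 1 w) - m w *
      (partial 1 (v 2) (graph_map f w) - partial 2 (v 1) (graph_map f w) * partial 1 f w)) /
    (V 2 w - V 1 w) ^+ 2.
  move=> Bw; rewrite (partial_div 1 (smooth_differentiable Sm Bw)
    (smooth_differentiable S21 Bw) (V21 w Bw)).
  by rewrite (dm1 w Bw) (partial1_V21 (B1W _ Bw)).
have dtb w : B1 w -> partial 0 tb w =
    (n w * form_a w * (V 2 w - V 0 w) - n w *
      (partial 0 (v 2) (graph_map f w) - partial 2 (v 0) (graph_map f w) * partial 0 f w)) /
    (V 2 w - V 0 w) ^+ 2.
  move=> Bw; rewrite (partial_div 0 (smooth_differentiable Sn Bw)
    (smooth_differentiable S20 Bw) (V20 w Bw)).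
  by rewrite (dn0 w Bw) (partial0_V20 (B1W _ Bw)).
have tab w : B1 w -> partial 1 ta w = partial 0 tb w.
  move=> Bw; have Ww := B1W _ Bw; rewrite (dta w Bw) (dtb w Bw).
  exact: (@hodograph_mixed R _ _ _ _ _ (f0 Ww) (f1 Ww) (V_sub_neq0 Ww n21)
    (V_sub_neq0 Ww n20) (V_sub_neq0 Ww n01)).
have [B2 [t [oB2 B2w0 B2B1 St tE]]] := poincare oB1 B1w0 Sta Stb tab.
pose xa w := - (V 1 w * ta w); pose xb w := - (V 0 w * tb w).
have Sxa : smooth B1 xa by apply: smoothN => //; exact: smoothM.
have Sxb : smooth B1 xb by apply: smoothN => //; exact: smoothM.
have xab w : B2 w -> partial 1 xa w = partial 0 xb w.
  move=> /B2B1 Bw; have Ww := B1W _ Bw.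
  have dV i := smooth_differentiable (SV i) Bw.
  have da := smooth_differentiable Sta Bw; have db := smooth_differentiable Stb Bw.
  rewrite (partialN 1 (differentiableM (dV 1) da)) (partialM 1 (dV 1) da).
  rewrite (partialN 0 (differentiableM (dV 0) db)) (partialM 0 (dV 0) db).
  rewrite -(tab w Bw) (dta w Bw) (partial0_V 0 Ww) (partial1_V 1 Ww).
  rewrite (v_lindeg 1 (WU Ww)) (v_lindeg 0 (WU Ww)) !add0r.
  exact: (@hodograph_mixed_x R _ _ _ _ _ (f0 Ww) (f1 Ww) (V_sub_neq0 Ww n21)
    (V_sub_neq0 Ww n20) (V_sub_neq0 Ww n01)).
have [B3 [x [oB3 B3w0 B3B2 Sx xE]]] := poincare oB2 B2w0
  (smooth_sub B2B1 Sxa) (smooth_sub B2B1 Sxb) xab.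
have ta0 w : B1 w -> ta w != 0.
  by move=> Bw; exact: (mulf_neq0 (m0 w) (invr_neq0 (V21 w Bw))).
have tb0 w : B1 w -> tb w != 0.
  move=> Bw; apply: (mulf_neq0 _ (invr_neq0 (V20 w Bw))).
  exact: (mulf_neq0 (m0 w) (invr_neq0 (q0 w Bw))).
exists B3, x, t; split; [exact: oB3|exact: B3w0| | |].
- by move=> w /B3B2/B2B1/B1W.
- by split; [exact: Sx|exact: smooth_sub B3B2 St].
split=> [w B3w|w /B3B2 B2w]; last first.
  by have [-> ->] := tE w B2w; split; [exact: ta0 (B2B1 _ B2w)|exact: tb0 (B2B1 _ B2w)].
have B2w := B3B2 _ B3w; have B1w := B2B1 _ B2w; have Ww := B1W _ B1w.
have [xa_ xb_] := xE w B3w; have [ta_ tb_] := tE w B2w.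
rewrite xa_ xb_ ta_ tb_ /xa /xb !mulNr; split; [exact: erefl|exact: erefl|].
rewrite -/(V 2 w) -/(V 1 w) -/(V 0 w) /ta /tb /n /q.
move: (V21 w B1w) (V20 w B1w) (f0 Ww) (f1 Ww).
gen_partial; move: (V 0 w) (V 1 w) (V 2 w) (m w) => u0 u1 u2 mw h1 h2 h3 h4.
by field; rewrite ?h1 ?h2 ?h3 ?h4.
Qed.

End HydrodynamicGraph.

(** * Changes of parametrization and graph pieces of a surface *)

Section LocalParametrization.
Context {R : realType}.

Lemma free_pairP n (x : 'I_2 -> 'rV[R]_n) :
  free [:: x 0; x 1] <->
  forall k : 'rV[R]_2, \sum_i k 0 i *: x i = 0 -> k = 0.
Proof.
have xE (i : 'I_2) : [:: x 0; x 1]`_i = x i by case: (ord2 i) => ->.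
split=> [/(@freeP _ _ 2 [tuple x 0; x 1]) H k k0|H].
  apply/rowP => i; rewrite mxE; apply: (H (fun i => k 0 i)).
  by rewrite -[RHS]k0; apply: eq_bigr => j _ /=; rewrite xE.
apply/(@freeP _ _ 2 [tuple x 0; x 1]) => k k0 i.
have /rowP/(_ i) : (\row_i k i : 'rV[R]_2) = 0.
  apply: H; rewrite -[RHS]k0; apply: eq_bigr => j _ /=.
  by rewrite xE mxE.
by rewrite !mxE.
Qed.

Lemma free_rV2 (x y : 'rV[R]_2) : free [:: x; y] -> x 0 0 * y 0 1 - x 0 1 * y 0 0 != 0.
Proof.
pose z (i : 'I_2) := if i == 0 then x else y.
rewrite -[X in free X]/[:: z 0; z 1] => /free_pairP H; apply/eqP => det0.
have comb a b : a * x 0 0 + b * y 0 0 = 0 -> a * x 0 1 + b * y 0 1 = 0 -> a = 0 /\ b = 0.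
  move=> e0 e1; have : plane_point a b = 0.
    apply: H; rewrite big_ord_recl big_ord1 /z /=.
    have -> : lift ord0 ord0 = 1 :> 'I_2 by exact: val_inj.
    rewrite plane_point0 plane_point1; apply/rowP => i; rewrite !mxE.
    by case: (ord2 i) => ->.
  move=> E; have := plane_point1 a b; have := plane_point0 a b.
  by rewrite E !mxE => <- <-.
have [y1 x1] : y 0 1 = 0 /\ - x 0 1 = 0.
  by apply: comb; rewrite mulNr; [rewrite -det0|]; ring.
have [y0 x0] : y 0 0 = 0 /\ - x 0 0 = 0.
  apply: comb; rewrite mulNr; first by ring.
  by move/eqP: x1; rewrite oppr_eq0 => /eqP ->; rewrite y1; ring.
have [/eqP] : (1 : R) = 0 /\ (0 : R) = 0; last by rewrite oner_eq0.
apply: comb; [move/eqP: x0|move/eqP: x1]; rewrite oppr_eq0 => /eqP ->; ring.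
Qed.

Lemma smooth_map_differentiable m n (W : set 'rV[R]_m) (r : 'rV[R]_m -> 'rV[R]_n) w :
  smooth_map W r -> W w -> differentiable r w.
Proof.
move=> Sr Ww; apply: differentiable_component => i.
exact: smooth_differentiable (Sr i) Ww.
Qed.

Lemma smooth_map_continuous m n (W : set 'rV[R]_m) (r : 'rV[R]_m -> 'rV[R]_n) w :
  smooth_map W r -> W w -> {for w, continuous r}.
Proof.
by move=> Sr Ww; exact: differentiable_continuous (smooth_map_differentiable Sr Ww).
Qed.

Lemma derive_component m n (r : 'rV[R]_m -> 'rV[R]_n) w j : differentiable r w ->
  'D_(delta_mx 0 j) r w = \row_i partial j (component r i) w.
Proof.
move=> dr; rewrite derive_mx; last exact: diff_derivable.
by apply/rowP => i; rewrite !mxE.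
Qed.

Lemma open_preimage m n (W : set 'rV[R]_m) (V : set 'rV[R]_n) (r : 'rV[R]_m -> 'rV[R]_n) :
  open W -> open V -> smooth_map W r -> open [set w | W w /\ V (r w)].
Proof.
move=> oW oV Sr; apply: norm_open => w [Ww Vw].
apply: near_norm; apply: near_and; first exact: open_nbhs_nbhs.
exact: (smooth_map_continuous Sr Ww) (open_nbhs_nbhs (conj oV Vw)).
Qed.

Definition diffeomorphism n (W Om : set 'rV[R]_n) (Phi sigma : 'rV[R]_n -> 'rV[R]_n) :=
  [/\ open W /\ open Om, smooth_map W Phi, smooth_map Om sigma,
    forall x, W x -> Om (Phi x) /\ sigma (Phi x) = x &
    forall y, Om y -> W (sigma y) /\ Phi (sigma y) = y].

Lemma inverse_diffeomorphism n (W : set 'rV[R]_n) Phi w0 :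
  open W -> smooth_map W Phi -> W w0 -> \det (jacmx Phi w0) != 0 ->
  exists W0 Om sigma, [/\ diffeomorphism W0 Om Phi sigma, W0 w0 & W0 `<=` W].
Proof.
move=> oW SP Ww0 J0.
have [W0 [Om [sigma [[oW0 oOm] [W0w0 W0W] HP HS SS]]]] := inverse_function oW SP Ww0 J0.
exists W0, Om, sigma; split=> //; split=> //.
  by move=> i; exact: smooth_sub W0W (SP i).
by move=> x /HP[].
Qed.

Lemma jacmx_diffeomorphism n (W Om : set 'rV[R]_n) Phi sigma y :
  diffeomorphism W Om Phi sigma -> Om y ->
  jacmx sigma y *m jacmx Phi (sigma y) = 1%:M.
Proof.
move=> [[oW oOm] SP SS HP HS] Oy; have [Ws _] := HS y Oy.
rewrite -jacmx_comp => [|i|i]; first last.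
- exact: smooth_differentiable (SS i) Oy.
- exact: smooth_differentiable (SP i) Ws.
apply/matrixP => j i; rewrite !mxE.
apply: (etrans (partial_congr j oOm (g := fun z : 'rV[R]_n => z 0 i) _ Oy)).
  by move=> z /HS[_ Ez]; rewrite /component /= Ez.
by rewrite partial_coord eq_sym.
Qed.

(** The partials of [r'] are combinations of those of [r] with the rows of the invertible
    [jacmx sigma] as coefficients, so independence is kept. For the open-image clause, the image of
    [W'] under [r'] is the image under [r] of an open preimage of [W']. *)
Lemma reparametrization (M : set 'rV[R]_3) (W W0 Om : set 'rV[R]_2) r r' Phi sigma :
  local_parametrization M W r -> W0 `<=` W -> diffeomorphism W0 Om Phi sigma ->
  (forall y, Om y -> r' y = r (sigma y)) ->
  local_parametrization M Om r'.
Proof.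
move=> [oW Sr fr ir hr] W0W D r'E; have [[oW0 oOm] SP SS HP HS] := D.
have OW y : Om y -> W (sigma y) by move=> /HS[/W0W].
have Sr' : smooth_map Om r'.
  move=> i; apply: (smooth_congr oOm _ (smooth_comp oOm OW SS (Sr i))).
  by move=> y Oy; rewrite /component r'E.
split=> //.
- move=> y Oy; have Ws := OW y Oy.
  apply/(free_pairP (fun j => 'D_(delta_mx 0 j) r' y)) => k k0.
  have kJ : k *m jacmx sigma y = 0.
    move/(free_pairP (fun j => 'D_(delta_mx 0 j) r (sigma y))): (fr _ Ws); apply.
    rewrite -[RHS]k0; apply/rowP => i; rewrite !summxE.
    under eq_bigr => l _.
      rewrite mxE (derive_component _ (smooth_map_differentiable Sr Ws)) !mxE mulr_suml.
      over.
    rewrite exchange_big /=; apply: eq_bigr => j _.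
    rewrite mxE (derive_component _ (smooth_map_differentiable Sr' Oy)) mxE.
    have -> : partial j (component r' i) y = partial j (component r i \o sigma) y.
      by apply: (partial_congr j oOm _ Oy) => z Oz; rewrite /component /= r'E.
    rewrite partial_comp; first last.
    + by move=> l; exact: smooth_differentiable (SS l) Oy.
    + exact: smooth_differentiable (Sr i) Ws.
    rewrite mulr_sumr; apply: eq_bigr => l _; rewrite mxE.
    by rewrite -mulrA; congr (_ * _); exact: mulrC.
  by rewrite -[k]mulmx1 -(jacmx_diffeomorphism D Oy) mulmxA kJ mul0mx.
- move=> y y'; rewrite !inE => Oy Oy'; rewrite !r'E // => E.
  have [_ <-] := HS y Oy; have [_ <-] := HS y' Oy'.
  by congr Phi; apply: ir => //; rewrite inE; exact: OW.
move=> W' oW' W'Om.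
have oP : open [set w | W0 w /\ W' (Phi w)] by exact: open_preimage.
have [|V oV VE] := hr _ oP; first by move=> w [/W0W].
exists V => //; rewrite -VE; apply/seteqP; split=> p [y].
  move=> W'y <-; exists (sigma y); last by rewrite r'E //; exact: W'Om.
  by have [Ws Es] := HS y (W'Om _ W'y); split=> //; rewrite Es.
move=> [W0y W'y] <-; exists (Phi y) => //.
by have [Oy sE] := HP y W0y; rewrite r'E // sE.
Qed.

Lemma local_parametrization_in (M : set 'rV[R]_3) W r w :
  local_parametrization M W r -> W w -> M (r w).
Proof.
move=> [oW _ _ _ hr] Ww; have [V _ E] := hr W oW (fun x => id).
suff : (M `&` V) (r w) by case.
by rewrite -E; exists w.
Qed.

Definition invariant_chart (r : 'rV[R]_2 -> 'rV[R]_3) w : 'rV[R]_2 :=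
  plane_point (component r 0 w) (component r 1 w).

Lemma component_chart0 r : component (invariant_chart r) 0 = component r 0.
Proof. by apply/funext => w; exact: plane_point0. Qed.

Lemma component_chart1 r : component (invariant_chart r) 1 = component r 1.
Proof. by apply/funext => w; exact: plane_point1. Qed.

Lemma smooth_chart W r : smooth_map W r -> smooth_map W (invariant_chart r).
Proof.
by move=> Sr i; case: (ord2 i) => ->; rewrite ?component_chart0 ?component_chart1; exact: Sr.
Qed.

Lemma invariant_chart_graph f w : invariant_chart (graph_map f) w = w.
Proof.
by rewrite /invariant_chart component_graph0 component_graph1 plane_pointE.
Qed.

Lemma graph_map_chart f r w : component r 2 w = f (invariant_chart r w) ->
  graph_map f (invariant_chart r w) = r w.
Proof.
move=> E; apply/rowP => i.
rewrite -[LHS]/(component (graph_map f) i (invariant_chart r w)).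
rewrite -[RHS]/(component r i w).
case: (ord3 i) => ->.
- by rewrite component_graph0 -[LHS]/(component (invariant_chart r) 0 w) component_chart0.
- by rewrite component_graph1 -[LHS]/(component (invariant_chart r) 1 w) component_chart1.
- by rewrite component_graph2.
Qed.

Lemma det_matrix2 (A : 'M[R]_2) : \det A = A 0 0 * A 1 1 - A 0 1 * A 1 0.
Proof.
rewrite (expand_det_row _ 0) big_ord_recl big_ord1 /cofactor !det_mx11 !mxE.
have -> : ord0 = 0 :> 'I_2 by exact: val_inj.
have -> : ord0 = 0 :> 'I_1 by exact: val_inj.
have e1 : lift (0 : 'I_2) (0 : 'I_1) = 1 by exact: val_inj.
have e0 : lift (1 : 'I_2) (0 : 'I_1) = 0 by exact: val_inj.
rewrite !e1 !e0.
rewrite expr0 mul1r expr1 mulN1r mulrN.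
by [].
Qed.

Lemma det_jacmx2 (Phi : 'rV[R]_2 -> 'rV[R]_2) w : \det (jacmx Phi w) =
  partial 0 (component Phi 0) w * partial 1 (component Phi 1) w -
  partial 0 (component Phi 1) w * partial 1 (component Phi 0) w.
Proof.
by rewrite det_matrix2 !mxE.
Qed.

Lemma transversal_det (M : set 'rV[R]_3) W r w i j : transversal_surface M ->
  local_parametrization M W r -> W w -> i != j ->
  partial 0 (component r i) w * partial 1 (component r j) w -
  partial 1 (component r i) w * partial 0 (component r j) w != 0.
Proof.
by move=> tM lr Ww ij; have := free_rV2 (tM W r lr w Ww i j ij); rewrite !mxE.
Qed.

Lemma chart_det (M : set 'rV[R]_3) W r w : transversal_surface M ->
  local_parametrization M W r -> W w -> \det (jacmx (invariant_chart r) w) != 0.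
Proof.
move=> tM lr Ww; have n01 : (0 : 'I_3) != 1 by [].
have := transversal_det tM lr Ww n01.
rewrite det_jacmx2 component_chart0 component_chart1.
by rewrite [X in _ - X]mulrC.
Qed.

(** On a graph, the independence of dR^1 and dR^3 is the nonvanishing of the slope along 1, and that
    of dR^2 and dR^3 the nonvanishing of the slope along 0. *)
Lemma graph_slopes (M : set 'rV[R]_3) W f w : transversal_surface M ->
  local_parametrization M W (graph_map f) -> W w ->
  partial 0 f w != 0 /\ partial 1 f w != 0.
Proof.
move=> tM lr Ww; have n12 : (1 : 'I_3) != 2 by [].
have n02 : (0 : 'I_3) != 2 by [].
have := transversal_det tM lr Ww n02; have := transversal_det tM lr Ww n12.
rewrite component_graph0 component_graph1 component_graph2 !partial_coord /=.
by gen_partial; rewrite !mul1r !mul0r subr0 sub0r oppr_eq0 => -> ->.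
Qed.

Lemma graph_smooth (M : set 'rV[R]_3) W f :
  local_parametrization M W (graph_map f) -> smooth W f.
Proof. by move=> [_ /(_ 2) + _ _ _]; rewrite component_graph2. Qed.

(** Independence of dR^1 and dR^2 makes [invariant_chart] a local diffeomorphism; composition with
    its inverse turns the first two components into the coordinates. *)
Lemma exists_graph (M : set 'rV[R]_3) p : smooth_surface M -> transversal_surface M ->
  M p -> exists W f, local_parametrization M W (graph_map f) /\ (graph_map f @` W) p.
Proof.
move=> sM tM Mp; have [W [r [lr [w1 Ww1 rw1]]]] := sM p Mp.
have [oW Sr _ _ _] := lr.
have [W0 [Om [sigma [D W0w W0W]]]] :=
  inverse_diffeomorphism oW (smooth_chart Sr) Ww1 (chart_det tM lr Ww1).
have [_ _ _ HP HS] := D.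
have E y : Om y -> graph_map (component r 2 \o sigma) y = r (sigma y).
  move=> Oy; have [_ yE] := HS y Oy.
  by rewrite -{1}yE; apply: graph_map_chart; rewrite /= yE.
exists Om, (component r 2 \o sigma); split; first exact: (reparametrization lr W0W D E).
have [Ow sw] := HP w1 W0w; exists (invariant_chart r w1) => //.
by rewrite E // sw.
Qed.

(** The image of the graph is relatively open in [M], so by continuity [r] stays in it near [w1].
    This is what allows an arbitrary parametrization to be compared with a given graph. *)
Lemma on_graph (M : set 'rV[R]_3) W f W1 r w0 w1 :
  local_parametrization M W (graph_map f) -> local_parametrization M W1 r ->
  W w0 -> W1 w1 -> r w1 = graph_map f w0 ->
  exists N, [/\ open N, N w1, N `<=` W1 & forall w, N w ->
    W (invariant_chart r w) /\ graph_map f (invariant_chart r w) = r w].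
Proof.
move=> lf lr Ww0 W1w1 rw1; have [oW _ _ _ hf] := lf; have [oW1 Sr _ _ _] := lr.
have [V oV VE] := hf W oW (fun x => id).
exists [set w | W1 w /\ V (r w)]; split.
- exact: open_preimage.
- split=> //; have : (graph_map f @` W) (r w1) by exists w0.
  by rewrite VE => -[].
- by move=> w [].
- move=> w [W1w Vw].
  have : (M `&` V) (r w) by split=> //; exact: local_parametrization_in lr W1w.
  rewrite -VE => -[w' Ww' rE].
  have -> : invariant_chart r w = w'.
    rewrite -[RHS](invariant_chart_graph f) /invariant_chart.
    by rewrite /component rE.
  by split.
Qed.

End LocalParametrization.

(** * Hydrodynamic surfaces and the web equation *)

Section Implications.
Context {R : realType} (U : set 'rV[R]_3) (v : 'I_3 -> 'rV[R]_3 -> R) (M : set 'rV[R]_3).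
Context (openU : open U) (v_smooth : forall i, smooth U (v i))
  (v_distinct : forall i j p, U p -> i != j -> v i p != v j p)
  (v_lindeg : linearly_degenerate U v) (v_semiham : semi_hamiltonian U v)
  (M_surface : smooth_surface M) (M_sub : M `<=` U)
  (M_transversal : transversal_surface M).

(** With [ui] the x-derivative of the i-th invariant, [vi * ui] is its t-derivative, and the six
    equations are the chain rule for the graph as a function of (x, t). The right sides equal to 1
    force [u0] and [u1] to be nonzero, which allows dividing by them. *)
Lemma hydrodynamic_chain (u0 u1 u2 v0 v1 v2 x0 x1 t0 t1 fa fb : R) :
  v0 - v1 != 0 ->
  u0 * x0 + v0 * u0 * t0 = 1 -> u0 * x1 + v0 * u0 * t1 = 0 ->
  u1 * x0 + v1 * u1 * t0 = 0 -> u1 * x1 + v1 * u1 * t1 = 1 ->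
  u2 * x0 + v2 * u2 * t0 = fa -> u2 * x1 + v2 * u2 * t1 = fb ->
  [/\ x1 = - v0 * t1, x0 = - v1 * t0, (v2 - v1) * t0 * fb = (v2 - v0) * t1 * fa &
    t0 != 0 /\ t1 != 0].
Proof.
move=> v01 e1 e2 e3 e4 e5 e6.
have u0n : u0 != 0.
  by apply: contra_eq_neq e1 => ->; rewrite mulr0 !mul0r addr0 eq_sym oner_neq0.
have u1n : u1 != 0.
  by apply: contra_eq_neq e4 => ->; rewrite mulr0 !mul0r addr0 eq_sym oner_neq0.
have h1 : x1 = - v0 * t1.
  by apply: (mulfI u0n); apply/eqP; rewrite -subr_eq0; apply/eqP; rewrite -[RHS]e2; ring.
have h0 : x0 = - v1 * t0.
  by apply: (mulfI u1n); apply/eqP; rewrite -subr_eq0; apply/eqP; rewrite -[RHS]e3; ring.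
split=> //; first by rewrite -e5 -e6 h0 h1; ring.
split.
  by apply: contra_eq_neq e1 => t00; rewrite h0 t00 !mulr0 addr0 eq_sym oner_neq0.
by apply: contra_eq_neq e4 => t10; rewrite h1 t10 !mulr0 addr0 eq_sym oner_neq0.
Qed.

Lemma hydrodynamic_web W f : hydrodynamic_surface v M ->
  local_parametrization M W (graph_map f) -> web_equation W f.
Proof.
move=> hM lf; have [oW _ _ _ _] := lf; have Sf := graph_smooth lf.
apply/(web_equation_dlog oW Sf) => [w Ww|w Ww|w0 Ww0].
- by have [] := graph_slopes M_transversal lf Ww.
- by have [] := graph_slopes M_transversal lf Ww.
have [W1 [r [lr [w1 W1w1 rw1] hr]]] := hM _ (local_parametrization_in lf Ww0).
have [oW1 Sr _ _ _] := lr.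
have [N [oN Nw1 NW1 NP]] := on_graph lf lr Ww0 W1w1 rw1.
have [W0 [Om [sigma [D W0w1 W0W1]]]] :=
  inverse_diffeomorphism oW1 (smooth_chart Sr) W1w1 (chart_det M_transversal lr W1w1).
have [[oW0 oOm] SP SS HP HS] := D.
(* On [B] the two components of [sigma] are x and t as functions of (R^1, R^2), and [r] composed
   with [sigma] is the given graph. *)
pose B := [set y | Om y /\ N (sigma y)].
have oB : open B by exact: open_preimage.
have E y : B y -> W y /\ graph_map f y = r (sigma y).
  by move=> [Oy /NP]; have [_ ->] := HS y Oy.
have w01 : invariant_chart r w1 = w0 by rewrite -[RHS](invariant_chart_graph f) /invariant_chart /component rw1.
have Bw0 : B w0 by have [] := HP w1 W0w1; rewrite w01 => Ow0 sw0; split=> //; rewrite sw0.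
have BW : B `<=` W by move=> y /E[].
have BOm : B `<=` Om by move=> y [].
have Sx : smooth B (component sigma 0) by exact: smooth_sub BOm (SS 0).
have St : smooth B (component sigma 1) by exact: smooth_sub BOm (SS 1).
have chain y i j : B y -> partial j (component (graph_map f) i) y =
    partial 0 (component r i) (sigma y) * partial j (component sigma 0) y +
    v i (graph_map f y) * partial 0 (component r i) (sigma y) *
      partial j (component sigma 1) y.
  move=> By; have [Oy Ns] := By; have W1s := NW1 _ Ns.
  have -> : partial j (component (graph_map f) i) y = partial j (component r i \o sigma) y.
    by apply: (partial_congr j oB _ By) => z /E[_]; rewrite /component /= => ->.
  rewrite partial_comp; first last.
  - by move=> l; exact: smooth_differentiable (SS l) Oy.
  - exact: smooth_differentiable (Sr i) W1s.
  rewrite big_ord_recl big_ord1.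
  have -> : lift ord0 ord0 = 1 :> 'I_2 by exact: val_inj.
  by rewrite (hr _ W1s i); have [_ ->] := E y By.
have sys y : B y -> [/\
    partial 1 (component sigma 0) y = - v 0 (graph_map f y) * partial 1 (component sigma 1) y,
    partial 0 (component sigma 0) y = - v 1 (graph_map f y) * partial 0 (component sigma 1) y,
    (v 2 (graph_map f y) - v 1 (graph_map f y)) * partial 0 (component sigma 1) y * partial 1 f y =
    (v 2 (graph_map f y) - v 0 (graph_map f y)) * partial 1 (component sigma 1) y * partial 0 f y &
    partial 0 (component sigma 1) y != 0 /\ partial 1 (component sigma 1) y != 0].
  move=> By; have n01 : (0 : 'I_3) != 1 by [].
  have Up : U (graph_map f y) by apply: M_sub; exact: local_parametrization_in lf (BW _ By).
  have c00 := chain y 0 0 By; have c01 := chain y 0 1 By.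
  have c10 := chain y 1 0 By; have c11 := chain y 1 1 By.
  have c20 := chain y 2 0 By; have c21 := chain y 2 1 By.
  rewrite component_graph0 !partial_coord in c00 c01.
  rewrite component_graph1 !partial_coord in c10 c11.
  rewrite component_graph2 in c20 c21.
  exact: (hydrodynamic_chain (v_sub_neq0 v_distinct Up n01) (esym c00) (esym c01)
    (esym c10) (esym c11) (esym c20) (esym c21)).
have slopes y : B y -> partial 0 f y != 0 /\ partial 1 f y != 0.
  by move=> /BW Wy; exact: graph_slopes M_transversal lf Wy.
apply: (@hodograph_web R U v openU v_smooth v_distinct v_lindeg v_semiham B f oB
  (smooth_sub BW Sf) _ _ _ _ _ Sx St).
- by move=> y /slopes[].
- by move=> y /slopes[].
- by move=> y /BW Wy; apply: M_sub; exact: local_parametrization_in lf Wy.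
- by move=> y /sys[e1 e2 e3 _]; split; [exact: e1|exact: e2|exact: e3].
- by move=> y /sys[_ _ _ [e _]]; exact: e.
- by move=> y /sys[_ _ _ [_ e]]; exact: e.
- exact: Bw0.
Qed.

(** [a0], [b0] are the x-derivatives and [a1], [b1] the t-derivatives of R^1 and R^2. The four
    linear equations say that their matrix is inverse to the Jacobian of (x, t); solving them gives
    the first two equations of the system, and the relation between [ta] and [tb] gives the
    third. *)
Lemma hodograph_inverse (v0 v1 v2 ta tb fa fb a0 a1 b0 b1 : R) :
  v0 - v1 != 0 -> ta != 0 -> tb != 0 ->
  (v2 - v1) * ta * fb = (v2 - v0) * tb * fa ->
  a0 * (- v1 * ta) + b0 * (- v0 * tb) = 1 -> a0 * ta + b0 * tb = 0 ->
  a1 * (- v1 * ta) + b1 * (- v0 * tb) = 0 -> a1 * ta + b1 * tb = 1 ->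
  [/\ a1 = v0 * a0, b1 = v1 * b0 &
    fa * a1 + fb * b1 = v2 * (fa * a0 + fb * b0)].
Proof.
move=> v01 ta0 tb0 E e1 e2 e3 e4.
have A0 : a0 = ((v0 - v1) * ta)^-1.
  apply: (mulIf (mulf_neq0 v01 ta0)); rewrite mulVf ?mulf_neq0 //.
  transitivity (a0 * (- v1 * ta) + b0 * (- v0 * tb) + v0 * (a0 * ta + b0 * tb)); first by ring.
  by rewrite e1 e2; ring.
have B0 : b0 = - ((v0 - v1) * tb)^-1.
  apply: (mulIf (mulf_neq0 v01 tb0)); rewrite mulNr mulVf ?mulf_neq0 //.
  transitivity (- (a0 * (- v1 * ta) + b0 * (- v0 * tb)) - v1 * (a0 * ta + b0 * tb)); first by ring.
  by rewrite e1 e2; ring.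
have A1 : a1 = v0 * a0.
  rewrite A0; apply: (mulIf (mulf_neq0 v01 ta0)); rewrite mulfVK ?mulf_neq0 //.
  transitivity (a1 * (- v1 * ta) + b1 * (- v0 * tb) + v0 * (a1 * ta + b1 * tb)); first by ring.
  by rewrite e3 e4; ring.
have B1 : b1 = v1 * b0.
  rewrite B0; apply: (mulIf (mulf_neq0 v01 tb0)).
  rewrite mulrN mulNr mulfVK ?mulf_neq0 //.
  transitivity (- (a1 * (- v1 * ta) + b1 * (- v0 * tb)) - v1 * (a1 * ta + b1 * tb)); first by ring.
  by rewrite e3 e4; ring.
split=> //; rewrite A1 B1 A0 B0.
apply/eqP; rewrite -subr_eq0; apply/eqP.
have -> : fa * (v0 * ((v0 - v1) * ta)^-1) + fb * (v1 * - ((v0 - v1) * tb)^-1) -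
   v2 * (fa * ((v0 - v1) * ta)^-1 + fb * - ((v0 - v1) * tb)^-1) =
   ((v2 - v1) * ta * fb - (v2 - v0) * tb * fa) / ((v0 - v1) * ta * tb).
  by field; rewrite ?v01 ?ta0 ?tb0.
by rewrite E subrr mul0r.
Qed.

(** The Jacobian of (x, t) with respect to (R^1, R^2) is (v^1 - v^2) t_1 t_2. *)
Lemma hodograph_det (v0 v1 a b : R) : v0 - v1 != 0 -> a != 0 -> b != 0 ->
  - v1 * a * b - a * (- v0 * b) != 0.
Proof.
move=> v01 a0 b0; rewrite (_ : _ - _ = (v0 - v1) * (a * b)); last by ring.
by rewrite !mulf_neq0.
Qed.

Lemma web_hydrodynamic :
  (forall W f, local_parametrization M W (graph_map f) -> web_equation W f) ->
  hydrodynamic_surface v M.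
Proof.
move=> web p Mp; have [W [f [lf [w0 Ww0 fw0]]]] := exists_graph M_surface M_transversal Mp.
have [oW _ _ _ _] := lf; have Sf := graph_smooth lf.
have f0 w : W w -> partial 0 f w != 0.
  by move=> Ww; have [] := graph_slopes M_transversal lf Ww.
have f1 w : W w -> partial 1 f w != 0.
  by move=> Ww; have [] := graph_slopes M_transversal lf Ww.
have WU w : W w -> U (graph_map f w).
  by move=> Ww; apply: M_sub; exact: local_parametrization_in lf Ww.
have [B [x [t [oB Bw0 BW [Sx St] [sys t0]]]]] :=
  @web_hodograph R U v openU v_smooth v_distinct v_lindeg v_semiham W f oW Sf f0 f1 WU
    w0 Ww0 ((web_equation_dlog oW Sf f0 f1).1 (web W f lf)).
pose Phi w : 'rV[R]_2 := plane_point (x w) (t w).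
have P0 : component Phi 0 = x by apply/funext => w; exact: plane_point0.
have P1 : component Phi 1 = t by apply/funext => w; exact: plane_point1.
have SPhi : smooth_map B Phi.
  by move=> i; case: (ord2 i) => ->; rewrite ?P0 ?P1.
have n01 : (0 : 'I_3) != 1 by [].
have v01 w : B w -> v 0 (graph_map f w) - v 1 (graph_map f w) != 0.
  by move=> /BW/WU Up; exact: (v_sub_neq0 v_distinct Up n01).
have J0 : \det (jacmx Phi w0) != 0.
  rewrite det_jacmx2 P0 P1; have [-> -> _] := sys w0 Bw0; have [ta0 tb0] := t0 w0 Bw0.
  exact: hodograph_det (v01 w0 Bw0) ta0 tb0.
have [W0 [Om [tau [D W0w0 W0B]]]] := inverse_diffeomorphism oB SPhi Bw0 J0.
have [[oW0 oOm] SP SS HP HS] := D.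
have W0W : W0 `<=` W by move=> w /W0B/BW.
exists Om, (graph_map f \o tau); split.
- exact: (reparametrization lf W0W D).
- have [Ow tw] := HP w0 W0w0; exists (Phi w0) => //=; by rewrite tw.
move=> y Oy.
have [W0y _] := HS y Oy; have By := W0B _ W0y.
have dS i : differentiable (component tau i) y := smooth_differentiable (SS i) Oy.
have dG j : partial j (f \o tau) y = partial 0 f (tau y) * partial j (component tau 0) y
    + partial 1 f (tau y) * partial j (component tau 1) y.
  rewrite (partial_comp j (smooth_differentiable Sf (BW _ By)) dS) big_ord_recl big_ord1.
  by have -> : lift ord0 ord0 = 1 :> 'I_2 by exact: val_inj.
have JE j i : partial j (component tau 0) y * partial 0 (component Phi i) (tau y) +
    partial j (component tau 1) y * partial 1 (component Phi i) (tau y) = (j == i)%:R.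
  have /matrixP/(_ j i) := jacmx_diffeomorphism D Oy.
  rewrite !mxE big_ord_recl big_ord1 !mxE.
  by have -> : lift ord0 ord0 = 1 :> 'I_2 by exact: val_inj.
have [xb xa E] := sys _ By; have [ta0 tb0] := t0 _ By.
have J00 := JE 0 0; have J01 := JE 0 1; have J10 := JE 1 0; have J11 := JE 1 1.
rewrite P0 xa xb in J00 J10; rewrite P1 in J01 J11.
have [H0 H1 H2] := hodograph_inverse (v01 _ By) ta0 tb0 E J00 J01 J10 J11.
move=> i; case: (ord3 i) => ->.
- have -> : component (graph_map f \o tau) 0 = component tau 0.
    by apply/funext => z; rewrite -[LHS]/(component (graph_map f) 0 (tau z)) component_graph0.
  exact: H0.
- have -> : component (graph_map f \o tau) 1 = component tau 1.
    by apply/funext => z; rewrite -[LHS]/(component (graph_map f) 1 (tau z)) component_graph1.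
  exact: H1.
have -> : component (graph_map f \o tau) 2 = f \o tau.
  by apply/funext => z; rewrite -[LHS]/(component (graph_map f) 2 (tau z)) component_graph2.
by rewrite !dG.
Qed.

End Implications.

(** * Hexagonality and the web equation *)

Section Hexagonality.
Context {R : realType}.

Lemma form_apply (A : 'rV[R]_2) (h : 'cV[R]_2) :
  (A *m h) 0 0 = A 0 0 * h 0 0 + A 0 1 * h 1 0.
Proof.
rewrite mxE big_ord_recl big_ord1.
by have -> : lift ord0 ord0 = 1 :> 'I_2 by exact: val_inj.
Qed.

Lemma form_eq (A B : 'rV[R]_2) (h : 'cV[R]_2) : A *m h = B *m h <->
  A 0 0 * h 0 0 + A 0 1 * h 1 0 = B 0 0 * h 0 0 + B 0 1 * h 1 0.
Proof.
rewrite -!form_apply; split=> [-> //|E].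
by apply/matrixP => i j; rewrite !ord1.
Qed.

Lemma form_eq0 (A : 'rV[R]_2) (h : 'cV[R]_2) : A *m h = 0 <->
  A 0 0 * h 0 0 + A 0 1 * h 1 0 = 0.
Proof.
rewrite -form_apply; split=> [-> |E]; first by rewrite mxE.
by apply/matrixP => i j; rewrite !ord1 E mxE.
Qed.

Lemma graph_hexagonal (W : set 'rV[R]_2) f : open W -> smooth W f ->
  (forall w, W w -> partial 0 f w != 0) -> (forall w, W w -> partial 1 f w != 0) ->
  web_equation W f -> hexagonal_web W (component (graph_map f)).
Proof.
move=> oW Sf f0 f1 /(web_equation_dlog oW Sf f0 f1) web.
have Sfj j := smooth_partial j Sf.
pose phi1 w := plane_point (partial 0 f w) 0.
pose phi2 w := plane_point 0 (- partial 1 f w).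
(* [phi1] has only a component 0 and [phi2] only a component 1, so the structure equation of each
   determines one component of the connection. *)
pose phi w := plane_point (partial 0 (partial 1 f) w / partial 1 f w)
  (partial 1 (partial 0 f) w / partial 0 f w).
have c10 : component phi1 0 = partial 0 f by apply/funext => w; exact: plane_point0.
have c11 : component phi1 1 = (fun=> 0) by apply/funext => w; exact: plane_point1.
have c20 : component phi2 0 = (fun=> 0) by apply/funext => w; exact: plane_point0.
have c21 : component phi2 1 = (fun w => - partial 1 f w).
  by apply/funext => w; exact: plane_point1.
have c0 : component phi 0 = (fun w => partial 0 (partial 1 f) w / partial 1 f w).
  by apply/funext => w; exact: plane_point0.
have c1 : component phi 1 = (fun w => partial 1 (partial 0 f) w / partial 0 f w).
  by apply/funext => w; exact: plane_point1.
have dfj j w (Ww : W w) := smooth_differentiable (Sfj j) Ww.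
exists phi1, phi2, phi; split.
- split.
  + move=> i; case: (ord2 i) => ->; first by rewrite c10.
    by rewrite c11; exact: smooth_cst.
  + move=> i; case: (ord2 i) => ->; first by rewrite c20; exact: smooth_cst.
    by rewrite c21; exact: smoothN.
  move=> w Ww h; have f0w := f0 w Ww; have f1w := f1 w Ww.
  rewrite component_graph0 component_graph1 component_graph2.
  have d00 : differential (fun w : 'rV[R]_2 => w 0 0) w 0 0 = 1 by rewrite mxE partial_coord.
  have d01 : differential (fun w : 'rV[R]_2 => w 0 0) w 0 1 = 0 by rewrite mxE partial_coord.
  have d10 : differential (fun w : 'rV[R]_2 => w 0 1) w 0 0 = 0 by rewrite mxE partial_coord.
  have d11 : differential (fun w : 'rV[R]_2 => w 0 1) w 0 1 = 1 by rewrite mxE partial_coord.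
  have d2 j : differential f w 0 j = partial j f w by rewrite mxE.
  split.
  + apply: (iff_trans (form_eq0 _ _)); apply: iff_trans (iff_sym (form_eq0 _ _)).
    rewrite d00 d01 /phi1 plane_point0 plane_point1 !(mul0r, mul1r, addr0).
    split=> [/eqP|->]; last by rewrite mulr0.
    by rewrite mulf_eq0 (negPf f0w) => /eqP.
  + apply: (iff_trans (form_eq0 _ _)); apply: iff_trans (iff_sym (form_eq0 _ _)).
    rewrite d10 d11 /phi2 plane_point0 plane_point1 !(mul0r, mul1r, add0r).
    split=> [/eqP|->]; last by rewrite mulr0.
    by rewrite mulNr oppr_eq0 mulf_eq0 (negPf f1w) => /eqP.
  + apply: (iff_trans (form_eq _ _ _)); apply: iff_trans (iff_sym (form_eq0 _ _)).
    rewrite !d2 /phi1 /phi2 !plane_point0 !plane_point1 !(mul0r, addr0, add0r) mulNr.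
    by split=> [->|/eqP]; [rewrite addNr|rewrite addr_eq0 => /eqP].
- split.
    move=> i; case: (ord2 i) => ->; rewrite ?c0 ?c1.
      by apply: smooth_div => //; exact: smooth_partial.
    by apply: smooth_div => //; exact: smooth_partial.
  move=> w Ww; rewrite /exterior /wedge c10 c11 c20 c21.
  rewrite /phi1 /phi2 /phi !plane_point0 !plane_point1 !partial_cst.
  rewrite (partialN 0 (dfj 1 w Ww)).
  move: (f0 w Ww) (f1 w Ww); move: (partial 0 f w) (partial 1 f w) => a b.
  gen_partial => a0 b0; split; field; rewrite ?a0 ?b0 //.
move=> w Ww; rewrite /exterior c0 c1.
have Sd0 j : smooth W (fun w => partial j (partial 0 f) w / partial 0 f w).
  by apply: smooth_div => //; exact: smooth_partial.
have Sd1 j : smooth W (fun w => partial j (partial 1 f) w / partial 1 f w).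
  by apply: smooth_div => //; exact: smooth_partial.
(* Once the order is exchanged in the first term, the curvature is the derivative along 1 of the
   difference of the logarithmic derivatives along 0 of the two slopes, that is, of q_1 / q in the
   notation of the overview. *)
apply: (etrans (congr2 (fun a b => a - b) (esym (dlogC 1 0 oW (Sfj 0) f0 Ww)) (erefl _))).
rewrite -(partialB 1 (smooth_differentiable (Sd0 0) Ww) (smooth_differentiable (Sd1 0) Ww)).
rewrite -[RHS](web w Ww).
apply: (partial_congr 1 oW _ Ww) => x Wx.
rewrite (partial_div 0 (dfj 0 x Wx) (dfj 1 x Wx) (f1 x Wx)).
move: (f0 x Wx) (f1 x Wx); move: (partial 0 f x) (partial 1 f x) => a b.
by gen_partial => a0 b0; field; rewrite ?a0 ?b0.
Qed.

(** Covectors with the same kernel are proportional, and the third family fixes the ratio of the two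
    factors. The factors are given by Cramer's formulas, from which their smoothness in the base
    point can be read off. *)
Lemma coframe_factors (P0 P1 Q0 Q1 u0 u1 v0 v1 fa fb : R) :
  u0 * v1 - u1 * v0 != 0 -> fa != 0 -> fb != 0 ->
  (forall a b, P0 * a + P1 * b = 0 <-> u0 * a + u1 * b = 0) ->
  (forall a b, Q0 * a + Q1 * b = 0 <-> v0 * a + v1 * b = 0) ->
  (forall a b, P0 * a + P1 * b = Q0 * a + Q1 * b <->
    (fa * u0 + fb * v0) * a + (fa * u1 + fb * v1) * b = 0) ->
  let alpha := (P0 * v1 - P1 * v0) / (u0 * v1 - u1 * v0) in
  let beta := (u0 * Q1 - u1 * Q0) / (u0 * v1 - u1 * v0) in
  [/\ P0 = alpha * u0 /\ P1 = alpha * u1, Q0 = beta * v0 /\ Q1 = beta * v1,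
    alpha != 0, beta != 0 & alpha = - beta * (fa / fb)].
Proof.
move=> D0 fa0 fb0 HP HQ HPQ alpha beta.
have P01 : P0 * u1 = P1 * u0.
  by apply/eqP; rewrite -subr_eq0 -mulrN; apply/eqP/HP; ring.
have Q01 : Q0 * v1 = Q1 * v0.
  by apply/eqP; rewrite -subr_eq0 -mulrN; apply/eqP/HQ; ring.
have Pu0 : P0 = alpha * u0.
  apply: (mulIf D0); rewrite /alpha mulrAC divfK //.
  transitivity (P0 * v1 * u0 - P0 * u1 * v0); first by ring.
  by rewrite P01; ring.
have Pu1 : P1 = alpha * u1.
  apply: (mulIf D0); rewrite /alpha mulrAC divfK //.
  transitivity (P1 * u0 * v1 - P1 * v0 * u1); first by ring.
  by rewrite -P01; ring.
have Qv0 : Q0 = beta * v0.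
  apply: (mulIf D0); rewrite /beta mulrAC divfK //.
  transitivity (Q0 * v1 * u0 - Q0 * u1 * v0); first by ring.
  by rewrite Q01; ring.
have Qv1 : Q1 = beta * v1.
  apply: (mulIf D0); rewrite /beta mulrAC divfK //.
  transitivity (Q1 * u0 * v1 - Q1 * v0 * u1); first by ring.
  by rewrite -Q01; ring.
clearbody alpha beta.
have a0 : alpha != 0.
  apply: contra_neq D0 => a0.
  have z a b : u0 * a + u1 * b = 0 by apply/HP; rewrite Pu0 Pu1 a0 !mul0r addr0.
  by have := z v1 (- v0); rewrite mulrN.
have ab : alpha = - beta * (fa / fb).
  (* The vector on which the covectors [u] and [v] take the values [fb] and [- fa]: it is tangent to
     the third family, where the two forms of the coframe agree. *)
  pose a := (fb * v1 + fa * u1) / (u0 * v1 - u1 * v0).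
  pose b := (- fb * v0 - fa * u0) / (u0 * v1 - u1 * v0).
  have ua : u0 * a + u1 * b = fb by rewrite /a /b; field.
  have va : v0 * a + v1 * b = - fa by rewrite /a /b; field.
  have : P0 * a + P1 * b = Q0 * a + Q1 * b.
    apply/HPQ; transitivity (fa * (u0 * a + u1 * b) + fb * (v0 * a + v1 * b)); first by ring.
    by rewrite ua va; ring.
  have -> : P0 * a + P1 * b = alpha * (u0 * a + u1 * b) by rewrite Pu0 Pu1; ring.
  have -> : Q0 * a + Q1 * b = beta * (v0 * a + v1 * b) by rewrite Qv0 Qv1; ring.
  by rewrite ua va => E; apply: (mulIf fb0); rewrite E; field.
split=> //; apply: contra_neq a0 => b0.
by rewrite ab b0 oppr0 mul0r.
Qed.

(* The covector [p - dA / A + (qa / q) du] has zero wedge product with both [du]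
   and [dv]. *)
Lemma connection_formula (A B p0 p1 a0 a1 b0 b1 u0 u1 v0 v1 q qa qb : R) :
  u0 * v1 - u1 * v0 != 0 -> A != 0 -> B != 0 -> q != 0 -> A = - B * q ->
  a0 * u1 - a1 * u0 = p0 * (A * u1) - p1 * (A * u0) ->
  b0 * v1 - b1 * v0 = p0 * (B * v1) - p1 * (B * v0) ->
  a0 = - b0 * q - B * (qa * u0 + qb * v0) ->
  a1 = - b1 * q - B * (qa * u1 + qb * v1) ->
  p0 = a0 / A - qa / q * u0 /\ p1 = a1 / A - qa / q * u1.
Proof.
move=> D0 A0 B0 q0 AB eA eB E0 E1.
pose X0 := p0 - (a0 / A - qa / q * u0); pose X1 := p1 - (a1 / A - qa / q * u1).
have Xu : X0 * u1 = X1 * u0.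
  apply: (mulIf A0); apply/eqP; rewrite -subr_eq0; apply/eqP.
  transitivity ((p0 * (A * u1) - p1 * (A * u0)) - (a0 * u1 - a1 * u0)).
    by rewrite /X0 /X1; field; rewrite ?A0 ?q0.
  by rewrite eA subrr.
have Xv : X0 * v1 = X1 * v0.
  apply: (mulIf B0); apply/eqP; rewrite -subr_eq0; apply/eqP.
  transitivity ((p0 * (B * v1) - p1 * (B * v0)) - (b0 * v1 - b1 * v0)).
    by rewrite /X0 /X1 E0 E1 AB; field; rewrite ?B0 ?q0.
  by rewrite eB subrr.
split; apply/eqP; rewrite -subr_eq0; apply/eqP; apply: (mulIf D0); rewrite mul0r.
  rewrite -/X0; transitivity (X0 * v1 * u0 - X0 * u1 * v0); first by ring.
  by rewrite Xu Xv; ring.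
rewrite -/X1; transitivity (X1 * u0 * v1 - X1 * v0 * u1); first by ring.
by rewrite -Xu -Xv; ring.
Qed.

(** For phi = d ln|alpha| - g du the exact part drops out of d phi, and - dg /\ du = g_2 du /\ dv;
    [b] is g_2. *)
Lemma flatness_forces_zero (u0 u1 v0 v1 a b c d g : R) : u0 * v1 - u1 * v0 != 0 ->
  c - ((a * u0 + b * v0) * u1 + g * d) - (c - ((a * u1 + b * v1) * u0 + g * d)) = 0 ->
  b = 0.
Proof.
move=> D0 E; apply: (mulIf D0); rewrite mul0r -[RHS]E; ring.
Qed.

(** Hexagonality provides its own parametrization and coframe. The coframe must be alpha dR^1, beta
    dR^2 with alpha = - beta q, which suffices to compute its connection form directly. *)
Lemma hexagonal_web_equation (M : set 'rV[R]_3) W f : transversal_surface M ->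
  hexagonal_surface M -> local_parametrization M W (graph_map f) -> web_equation W f.
Proof.
move=> tM hM lf; have [oW _ _ _ _] := lf; have Sf := graph_smooth lf.
have f0 w : W w -> partial 0 f w != 0 by move=> Ww; have [] := graph_slopes tM lf Ww.
have f1 w : W w -> partial 1 f w != 0 by move=> Ww; have [] := graph_slopes tM lf Ww.
apply/(web_equation_dlog oW Sf f0 f1) => w0 Ww0.
have [W1 [r [lr [w1 W1w1 rw1] [phi1 [phi2 [phi [[S1 S2 cof] [Sphi conn] flat]]]]]]] :=
  hM _ (local_parametrization_in lf Ww0).
have [oW1 Sr _ _ _] := lr.
have [N [oN Nw1 NW1 NP]] := on_graph lf lr Ww0 W1w1 rw1.
have n01 : (0 : 'I_3) != 1 by [].
set u := component r 0; set v := component r 1; set h := component r 2.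
pose D w := partial 0 u w * partial 1 v w - partial 1 u w * partial 0 v w.
have D0 w : N w -> D w != 0 by move=> /NW1 W1w; exact: (transversal_det tM lr W1w n01).
have SN g : smooth W1 g -> smooth N g by exact: smooth_sub.
have Su : smooth N u by apply: SN; exact: Sr.
have Sv : smooth N v by apply: SN; exact: Sr.
have Suj j := smooth_partial j Su; have Svj j := smooth_partial j Sv.
have Sp1 i : smooth N (component phi1 i) by apply: SN; exact: S1.
have Sp2 i : smooth N (component phi2 i) by apply: SN; exact: S2.
have SD : smooth N D by apply: smoothB => //; exact: smoothM.
pose Phi := invariant_chart r.
have SPhi : smooth_map N Phi.
  by move=> i; apply: SN; exact: (smooth_chart Sr).
have NPhi w : N w -> W (Phi w) by move=> /NP[].
have hE w : N w -> h w = f (Phi w).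
  by move=> /NP[_ E]; rewrite /h /component -E -[LHS]/(component (graph_map f) 2 (Phi w)) component_graph2.
have Phi0 : component Phi 0 = u by exact: component_chart0.
have Phi1 : component Phi 1 = v by exact: component_chart1.
have chain (g : 'rV[R]_2 -> R) w j : smooth W g -> N w ->
    partial j (fun x => g (Phi x)) w =
    partial 0 g (Phi w) * partial j u w + partial 1 g (Phi w) * partial j v w.
  move=> Sg Nw; rewrite -[LHS]/(partial j (g \o Phi) w) partial_comp; first last.
  - by move=> i; exact: smooth_differentiable (SPhi i) Nw.
  - exact: smooth_differentiable Sg (NPhi w Nw).
  rewrite big_ord_recl big_ord1.
  have -> : lift ord0 ord0 = 1 :> 'I_2 by exact: val_inj.
  by rewrite Phi0 Phi1.
pose q w := partial 0 f w / partial 1 f w.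
have Sq : smooth W q by apply: smooth_div => //; exact: smooth_partial.
have q0 w : W w -> q w != 0.
  by move=> Ww; exact: (mulf_neq0 (f0 w Ww) (invr_neq0 (f1 w Ww))).
pose alpha w := (component phi1 0 w * partial 1 v w - component phi1 1 w * partial 0 v w) / D w.
pose beta w := (partial 0 u w * component phi2 1 w - partial 1 u w * component phi2 0 w) / D w.
have Sa : smooth N alpha by apply: smooth_div => //; apply: smoothB => //; exact: smoothM.
have Sb : smooth N beta by apply: smooth_div => //; apply: smoothB => //; exact: smoothM.
have factors w : N w -> [/\
    component phi1 0 w = alpha w * partial 0 u w /\ component phi1 1 w = alpha w * partial 1 u w,
    component phi2 0 w = beta w * partial 0 v w /\ component phi2 1 w = beta w * partial 1 v w,
    alpha w != 0, beta w != 0 & alpha w = - beta w * q (Phi w)].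
  move=> Nw; have W1w := NW1 w Nw; have Ww := NPhi w Nw.
  pose hv a b : 'cV[R]_2 := (plane_point a b)^T.
  have h0 a b : hv a b 0 0 = a by rewrite mxE plane_point0.
  have h1 a b : hv a b 1 0 = b by rewrite mxE plane_point1.
  have dE g j : differential g w 0 j = partial j g w by rewrite mxE.
  have dh j : partial j h w =
      partial 0 f (Phi w) * partial j u w + partial 1 f (Phi w) * partial j v w.
    by rewrite -chain //; exact: (partial_congr j oN hE Nw).
  apply: coframe_factors; [exact: D0|exact: f0|exact: f1|..] => a b;
    have [c0 c1 c2] := cof w W1w (hv a b).
  - move: (iff_trans (iff_sym (form_eq0 _ _)) (iff_trans c0 (form_eq0 _ _))).
    by rewrite h0 h1 !dE.
  - move: (iff_trans (iff_sym (form_eq0 _ _)) (iff_trans c1 (form_eq0 _ _))).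
    by rewrite h0 h1 !dE.
  - move: (iff_trans (iff_sym (form_eq _ _ _)) (iff_trans c2 (form_eq0 _ _))).
    by rewrite h0 h1 !dE !dh.
have du j w (Nw : N w) := smooth_differentiable (Suj j) Nw.
have dv j w (Nw : N w) := smooth_differentiable (Svj j) Nw.
pose g w := partial 0 q w / q w.
have Sg : smooth W g by apply: smooth_div => //; exact: smooth_partial.
have SgP : smooth N (fun w => g (Phi w)) := smooth_comp oN NPhi SPhi Sg.
have SqP : smooth N (fun w => q (Phi w)) := smooth_comp oN NPhi SPhi Sq.
(* phi = d ln|alpha| - g du, with [g] taken at (R^1, R^2). The choice of the coframe enters only
   through the first, closed part. *)
have phiE w : N w ->
    component phi 0 w = partial 0 alpha w / alpha w - g (Phi w) * partial 0 u w /\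
    component phi 1 w = partial 1 alpha w / alpha w - g (Phi w) * partial 1 u w.
  move=> Nw; have [[P0 P1] [Q0 Q1] a0 b0 ab] := factors w Nw.
  have da := smooth_differentiable Sa Nw; have db := smooth_differentiable Sb Nw.
  have ext (c k : 'rV[R]_2 -> R) (form : form1) : smooth N c -> smooth N k ->
      (forall w, N w -> component form 0 w = c w * partial 0 k w /\
        component form 1 w = c w * partial 1 k w) ->
      exterior form w = partial 0 c w * partial 1 k w - partial 1 c w * partial 0 k w.
    move=> Sc Sk F; rewrite /exterior.
    have dc := smooth_differentiable Sc Nw.
    have dk j := smooth_differentiable (smooth_partial j Sk) Nw.
    rewrite (partial_congr 0 oN (fun x Nx => (F x Nx).2) Nw).
    rewrite (partial_congr 1 oN (fun x Nx => (F x Nx).1) Nw).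
    rewrite (partialM 0 dc (dk 1)) (partialM 1 dc (dk 0)).
    rewrite (partialC 0 1 oN (Sk 2%N) Nw).
    by gen_partial; move: (c w) => c1 *; ring.
  have [e1 e2] := conn w (NW1 w Nw).
  have E1 := ext alpha u phi1 Sa Su (fun x Nx => let: And5 p _ _ _ _ := factors x Nx in p).
  have E2 := ext beta v phi2 Sb Sv (fun x Nx => let: And5 _ p _ _ _ := factors x Nx in p).
  have dalpha j : partial j alpha w = - partial j beta w * q (Phi w) -
      beta w * (partial 0 q (Phi w) * partial j u w + partial 1 q (Phi w) * partial j v w).
    have F x : N x -> alpha x = (- beta x) * q (Phi x) by move=> /factors[].
    rewrite (partial_congr j oN F Nw).
    rewrite (partialM j (differentiableN db) (smooth_differentiable SqP Nw)).
    rewrite (partialN j db) (chain q w j Sq Nw).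
    by congr (_ + _); exact: mulNr.
  apply: (connection_formula (D0 w Nw) a0 b0 (q0 _ (NPhi w Nw)) ab _ _ (dalpha 0) (dalpha 1)).
    by rewrite -E1 e1 /wedge -/(component phi1 0 w) -/(component phi1 1 w) P0 P1.
  by rewrite -E2 e2 /wedge -/(component phi2 0 w) -/(component phi2 1 w) Q0 Q1.
have w01 : Phi w1 = w0.
  by rewrite -[RHS](invariant_chart_graph f) /Phi /invariant_chart /component rw1.
suff : partial 1 g w0 = 0 by [].
have := flat w1 W1w1; rewrite /exterior.
rewrite (partial_congr 0 oN (fun x Nx => (phiE x Nx).2) Nw1).
rewrite (partial_congr 1 oN (fun x Nx => (phiE x Nx).1) Nw1).
have a0 w : N w -> alpha w != 0 by move=> /factors[].
have Sda j : smooth N (fun w => partial j alpha w / alpha w).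
  by apply: smooth_div => //; exact: smooth_partial.
have dda j := smooth_differentiable (Sda j) Nw1.
have dg := smooth_differentiable SgP Nw1.
rewrite (partialB 0 (dda 1) (differentiableM dg (du 1 w1 Nw1))) (partialM 0 dg (du 1 w1 Nw1)).
rewrite (partialB 1 (dda 0) (differentiableM dg (du 0 w1 Nw1))) (partialM 1 dg (du 0 w1 Nw1)).
rewrite (dlogC 0 1 oN Sa a0 Nw1) (partialC 0 1 oN (Su 2%N) Nw1).
rewrite (chain g w1 0 Sg Nw1) (chain g w1 1 Sg Nw1) w01.
exact: flatness_forces_zero (D0 w1 Nw1).
Qed.

End Hexagonality.

Unset Implicit Arguments.

(** The second clause gives content to the third: graph pieces cover [M], so a condition on all of
    them is a condition on the whole surface. *)
Theorem mainTheorem2 (R : realType) (U : set 'rV[R]_3)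
    (v : 'I_3 -> 'rV[R]_3 -> R) (M : set 'rV[R]_3)
    (openU : open U)
    (v_smooth : forall i, smooth U (v i))
    (v_distinct : forall i j p, U p -> i != j -> v i p != v j p)
    (v_lindeg : linearly_degenerate U v)
    (v_semiham : semi_hamiltonian U v)
    (M_surface : smooth_surface M)
    (M_sub : M `<=` U)
    (M_transversal : transversal_surface M) :
  [/\ hydrodynamic_surface v M <-> hexagonal_surface M,
      forall p, M p -> exists W f,
        local_parametrization M W (graph_map f) /\ (graph_map f @` W) p
    & hydrodynamic_surface v M <->
      (forall W f, local_parametrization M W (graph_map f) ->
        web_equation W f)].
Proof.
have graphs p (Mp : M p) := exists_graph M_surface M_transversal Mp.
have hydro_web : hydrodynamic_surface v M <->
    (forall W f, local_parametrization M W (graph_map f) -> web_equation W f).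
  split=> [hM W f|]; last exact: (web_hydrodynamic openU).
  exact: (hydrodynamic_web openU v_smooth v_distinct v_lindeg v_semiham M_sub).
split=> //; split=> [/hydro_web web p Mp|hM].
  have [W [f [lf pW]]] := graphs p Mp; exists W, (graph_map f); split=> //.
  have [oW _ _ _ _] := lf.
  apply: graph_hexagonal (graph_smooth lf) _ _ (web W f lf) => // w Ww.
    by have [] := graph_slopes M_transversal lf Ww.
  by have [] := graph_slopes M_transversal lf Ww.
by apply/hydro_web => W f; exact: hexagonal_web_equation.
Qed.
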